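(* Let $\Omega\subset\mathbb{R}^3$ be open, bounded and connected with Lipschitz boundary. Let $\boldsymbol\varphi\in H^1(\Omega;\mathbb{R}^3)$ with $\nabla\boldsymbol\varphi\in BV(\Omega;\mathbb{R}^{3\times3})$. Then there exists $\mathbf b\in L^1(S_{\nabla\boldsymbol\varphi};\mathbb{R}^3)$ such that $$(\nabla\boldsymbol\varphi)^+(\mathbf x)-(\nabla\boldsymbol\varphi)^-(\mathbf x)=\mathbf b(\mathbf x)\otimes\mathbf m(\mathbf x)\qquad\text{for }\mathscr H^2\text{-a.e. }\mathbf x\in S_{\nabla\boldsymbol\varphi},$$ with $\mathbf m(\mathbf x)$ being the normal to $S_{\nabla\boldsymbol\varphi}$ at $\mathbf x$.
   Context: For a $BV$ function $u$, $S_u$ denotes its jump set (countably $\mathscr H^2$-rectifiable), and $u^+,u^-$ the traces of $u$ on the two sides of $S_u$. $\mathscr H^2$ is two-dimensional Hausdorff measure, and $L^1(S_{\nabla\boldsymbol\varphi};\mathbb{R}^3)$ is taken with respect to $\mathscr H^2$ restricted to $S_{\nabla\boldsymbol\varphi}$. *)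

(* Defs.v *)
From HB Require Import structures.
From mathcomp Require Import all_boot all_order all_algebra.
From mathcomp Require Import all_classical all_reals all_analysis.

Set Implicit Arguments.
Unset Strict Implicit.
Unset Printing Implicit Defensive.
Import Order.TTheory GRing.Theory Num.Theory.
Import numFieldNormedType.Exports.

Local Open Scope classical_set_scope.
Local Open Scope ring_scope.

(* Points of R^n are row vectors, so the gradient of f : R^n -> R^m is the
   m x n matrix whose (i, j) entry is the j-th partial derivative of f_i. *)

(* The library norm on matrices is the sup norm; balls, diameters and moduli
   below use the Euclidean (Frobenius) norm instead. *)
Definition enorm {R : realType} {m n} (A : 'M[R]_(m, n)) : R :=
  Num.sqrt (\sum_i \sum_j A i j ^+ 2).

Definition dotv {R : realType} {n} (u v : 'rV[R]_n) : R :=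
  \sum_i u 0 i * v 0 i.

Definition tensor {R : realType} {m n} (b : 'rV[R]_m) (v : 'rV[R]_n) :
  'M[R]_(m, n) := b^T *m v.

(* The sigma-algebra generated by the coordinates, as the library does for
   tuples; since R is second countable it is the Borel sigma-algebra. *)
Definition rV_coord {R : realType} {n} (i : 'I_n) (x : 'rV[R]_n) : R := x 0 i.

Definition rV_display : measure_display. Proof. exact: default_measure_display. Qed.

Section measurable_rV.
Context {R : realType} {n : nat}.
Let rV_meas : set (set 'rV[R]_n) := g_sigma_preimage (@rV_coord R n).

Let rV_meas0 : rV_meas set0. Proof. exact: sigma_algebra0. Qed.

Let rV_measC A : rV_meas A -> rV_meas (~` A).
Proof. exact: sigma_algebraC. Qed.

Let rV_meas_bigcup (F : (set 'rV[R]_n)^nat) :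
  (forall i, rV_meas (F i)) -> rV_meas (\bigcup_i F i).
Proof. exact: sigma_algebra_bigcup. Qed.

HB.instance Definition _ := @isMeasurable.Build rV_display 'rV[R]_n rV_meas
  rV_meas0 rV_measC rV_meas_bigcup.

End measurable_rV.

Section lebesgue3.
Context {R : realType}.
Local Notation leb := (@lebesgue_measure R).

Definition vec3 (p : R * R * R) : 'rV[R]_3 :=
  \row_i [:: p.1.1; p.1.2; p.2]`_i.

Lemma measurable_vec3 : measurable_fun [set: R * R * R] vec3.
Proof.
pose G := \big[setU/set0]_(i < 3) preimage_set_system setT (@rV_coord R 3 i) measurable.
apply: (@measurability _ _ _ _ _ _ G (erefl _)) => _ [B + <-].
rewrite /G -bigcup_seq => -[i _ [A mA <-]]; rewrite !setTI.
have mT (f : R * R * R -> R) : measurable_fun setT f -> measurable (f @^-1` A).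
  by move=> mf; rewrite -[X in measurable X]setTI; exact: mf.
rewrite -comp_preimage; apply: mT.
rewrite (_ : _ \o _ = fun p : R * R * R => [:: p.1.1; p.1.2; p.2]`_i); last first.
  by apply/funext => p; rewrite /rV_coord /vec3 /= mxE.
case: i => -[|[|[|//]]] _ /=.
- exact: (measurableT_comp measurable_fst measurable_fst).
- exact: (measurableT_comp measurable_snd measurable_fst).
- exact: measurable_snd.
Qed.

Definition lebesgue3 : set 'rV[R]_3 -> \bar R :=
  pushforward ((leb \x leb) \x leb)%E vec3.

HB.instance Definition _ := Measure.copy lebesgue3
  (@measure_function_pushforward__canonical__measure_function_Measure _ _ _ _ _
     ((leb \x leb) \x leb)%E vec3 measurable_vec3).

End lebesgue3.

Section hausdorff2.
Context {R : realType}.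
Local Notation V := 'rV[R]_3.
Local Open Scope ereal_scope.

(* The point 0 makes the diameter of the empty set 0 rather than -oo. *)
Definition ediam (E : set V) : \bar R :=
  ereal_sup (0 |` [set (enorm (x - y)%R)%:E | x in E & y in E]).

(* Normalized by omega_2 / 2 ^ 2 = pi / 4, as is usual. *)
Definition hausdorff2_pre (delta : R) (A : set V) : \bar R :=
  ereal_inf [set \sum_(k <oo) (pi / 4)%:E * ediam (F k) ^+ 2 | F in
    [set F : (set V)^nat | A `<=` \bigcup_k F k /\
                           forall k, ediam (F k) <= delta%:E]].

Definition hausdorff2 (A : set V) : \bar R :=
  ereal_sup [set hausdorff2_pre delta A | delta in [set delta | (0 < delta)%R]].

Lemma ediam_ge0 E : 0 <= ediam E.
Proof. by apply: ereal_sup_ubound; left. Qed.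

Lemma ediam0 : ediam set0 = 0.
Proof.
apply/eqP; rewrite eq_le ediam_ge0 andbT; by apply: ge_ereal_sup => e [->//|[x []]].
Qed.

(* Carathéodory gauge whose mu_ext is hausdorff2_pre; every set is allowed in
   the covers. *)
Let gauge (delta : R) (E : set (g_sigma_algebraType (@setT (set V)))) : \bar R :=
  if ediam E <= delta%:E then (pi / 4)%:E * ediam E ^+ 2 else +oo.

Let pi4_ge0 : 0 <= (pi / 4 : R)%:E.
Proof. by rewrite lee_fin divr_ge0// pi_ge0. Qed.

Let gauge_ge0 delta E : 0 <= gauge delta E.
Proof.
by rewrite /gauge; case: ifPn => // _; rewrite mule_ge0// expe_ge0// ediam_ge0.
Qed.

Let gauge0 delta : (0 < delta)%R -> gauge delta set0 = 0.
Proof.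
by move=> d0; rewrite /gauge ediam0 lee_fin (ltW d0) expe2 mule0 mule0.
Qed.

Let hausdorff2_preE delta A : hausdorff2_pre delta A = mu_ext (gauge delta) A.
Proof.
apply/eqP; rewrite eq_le; apply/andP; split.
- apply: le_ereal_inf_tmp => _ [F [_ AF] <-].
  have [Fd|/existsNP[k /negP Fk]] := pselect (forall k, ediam (F k) <= delta%:E).
    apply: ereal_inf_lbound; exists F => //.
    by apply: eq_eseriesr => k _; rewrite /gauge Fd.
  rewrite (eseries_pinfty (k := k)) ?leey// => [n _|].
    by rewrite -ltNye (lt_le_trans _ (gauge_ge0 _ _)).
  by rewrite /gauge (negbTE Fk).
- apply: le_ereal_inf_tmp => _ [F [AF Fd] <-].
  apply: ereal_inf_lbound; exists F.
    by split=> // i; exact: sub_sigma_algebra.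
  by apply: eq_eseriesr => k _; rewrite /gauge Fd.
Qed.

Let hausdorff20 : hausdorff2 set0 = 0.
Proof.
rewrite /hausdorff2 (_ : [set _ | _ in _] = [set 0]) ?ereal_sup1//.
apply/seteqP; split=> [_ [d d0 <-]|_ ->] /=.
  by rewrite hausdorff2_preE mu_ext0//; exact: gauge0.
by exists 1%R => //=; rewrite hausdorff2_preE mu_ext0//; exact: gauge0.
Qed.

Let hausdorff2_ge0 A : 0 <= hausdorff2 A.
Proof.
apply: (@le_trans _ _ (hausdorff2_pre 1 A)).
  by rewrite hausdorff2_preE; exact: mu_ext_ge0.
by apply: ereal_sup_ubound; exists 1%R => /=.
Qed.

Let le_hausdorff2 : {homo hausdorff2 : A B / A `<=` B >-> A <= B}.
Proof.
move=> A B AB; apply: ge_ereal_sup => _ [d d0 <-].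
apply: (@le_trans _ _ (hausdorff2_pre d B)).
  by rewrite !hausdorff2_preE; exact: le_mu_ext.
by apply: ereal_sup_ubound; exists d.
Qed.

Let hausdorff2_sigma_subadditive : sigma_subadditive hausdorff2.
Proof.
move=> F; apply: ge_ereal_sup => _ [d d0 <-]; rewrite hausdorff2_preE.
apply: le_trans (mu_ext_sigma_subadditive _ _) _; first exact: gauge_ge0.
apply: lee_nneseries => [k _ _|k _]; first by apply: mu_ext_ge0; exact: gauge_ge0.
by rewrite -hausdorff2_preE; apply: ereal_sup_ubound; exists d.
Qed.

HB.instance Definition _ := isOuterMeasure.Build R V hausdorff2
  hausdorff20 hausdorff2_ge0 le_hausdorff2 hausdorff2_sigma_subadditive.

Definition hausdorff_type := caratheodory_type hausdorff2.

HB.instance Definition _ := Measurable.copy hausdorff_type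
  (caratheodory_type ((hausdorff2 : {outer_measure set V -> \bar R}))).

Definition hausdorff2_measure : set hausdorff_type -> \bar R := hausdorff2.

HB.instance Definition _ := isMeasure.Build _ _ _ hausdorff2_measure
  (@caratheodory_measure0 R V hausdorff2) (@caratheodory_measure_ge0 R V hausdorff2)
  (@caratheodory_measure_sigma_additive R V hausdorff2).

End hausdorff2.

Section function_spaces.
Context {R : realType}.
Local Notation V := 'rV[R]_3.
Implicit Types (Omega : set V) (psi f : V -> R).

Definition partial (j : 'I_3) f : V -> R := 'D_(delta_mx 0 j) f.

Fixpoint Ck (k : nat) f : Prop :=
  continuous f /\
  if k is k'.+1 then
    forall j, (forall x, derivable f x (delta_mx 0 j)) /\ Ck k' (partial j f)
  else True.

Definition support_of f : set V := closure [set x | f x != 0].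

Definition test_function Omega psi : Prop :=
  [/\ forall k, Ck k psi, compact (support_of psi) & support_of psi `<=` Omega].

Definition L1loc Omega f : Prop :=
  forall K, compact K -> K `<=` Omega -> lebesgue3.-integrable K (EFin \o f).

Definition L2 Omega f : Prop := (f \_ Omega) \in Lfun lebesgue3 2%:E.

Definition weak_gradient Omega (u : V -> V) (G : V -> 'M[R]_3) : Prop :=
  forall i j, let ui := (fun x => u x 0 i) in let Gij := (fun x => G x i j) in
  [/\ L1loc Omega ui, L1loc Omega Gij &
      forall psi, test_function Omega psi ->
        \int[lebesgue3]_(x in Omega) (ui x * partial j psi x) =
        - \int[lebesgue3]_(x in Omega) (Gij x * psi x)].

Definition sobolev_H1 Omega (u : V -> V) : Prop :=
  (forall i, L2 Omega (fun x => u x 0 i)) /\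
  exists2 G, weak_gradient Omega u G &
             forall i j, L2 Omega (fun x => G x i j).

(* f is in L^1(Omega) and each D_j f is a finite signed Radon measure, given
   as the difference of two finite Borel measures. *)
Definition BV Omega f : Prop :=
  lebesgue3.-integrable Omega (EFin \o f) /\
  forall j, exists mup mun : {finite_measure set V -> \bar R},
    forall psi, test_function Omega psi ->
      \int[lebesgue3]_(x in Omega) (f x * partial j psi x) =
      - (\int[mup]_(x in Omega) psi x - \int[mun]_(x in Omega) psi x).

Definition BV_mx Omega (U : V -> 'M[R]_3) : Prop :=
  forall i j, BV Omega (fun x => U x i j).

(* Near each boundary point, in the orthonormal coordinates given by the
   columns of Q, Omega is the set above the graph of a Lipschitz function of
   the first two coordinates. *)
Definition lipschitz_boundary Omega : Prop :=
  forall x, closure Omega x -> ~ interior Omega x ->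
  exists (Q : 'M[R]_3) (g : 'rV[R]_2 -> R) (r : R),
    [/\ Q^T *m Q = 1%:M, lipschitz g, 0 < r &
        forall y, enorm (y - x) < r ->
          let z : 'rV[R]_(2 + 1) := (y - x) *m Q in
          Omega y <-> g (lsubmx z) < rsubmx z 0 0].

End function_spaces.

Section jump_set.
Context {R : realType}.
Local Notation V := 'rV[R]_3.
Implicit Types (Omega : set V) (U : V -> 'M[R]_3).

Definition half_ball (x nu : V) (r : R) : set V :=
  [set y | enorm (y - x) < r /\ 0 < dotv (y - x) nu].

(* A is the trace of U at x on the side nu points to: the averages of |U - A|
   over half balls shrinking to x tend to 0. *)
Definition one_sided_trace U (x nu : V) (A : 'M[R]_3) : Prop :=
  ((lebesgue3 (half_ball x nu r))^-1 *
   \int[lebesgue3]_(y in half_ball x nu r) (enorm (U y - A))%:E)%E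
  @[r --> 0^'+] --> 0%E.

(* x is a jump point of U with traces Up, Um and unit normal nu, which points
   to the side of Up.  The triple is unique up to replacing (Up, Um, nu) by
   (Um, Up, - nu). *)
Definition jump_triple Omega U (x : V) (Up Um : 'M[R]_3) (nu : V) : Prop :=
  [/\ Omega x, enorm nu = 1, Up != Um,
      one_sided_trace U x nu Up & one_sided_trace U x (- nu) Um].

Definition jump_set Omega U : set V :=
  [set x | exists Up Um nu, jump_triple Omega U x Up Um nu].

End jump_set.

(* Main.v *)
(** Write [U = Dphi] and [J = Up - Um] at a jump point [x] with normal [m].
    Pair [U] with the gradients of the radial bumps [psi (n (y - x))].  As
    [n -> oo], the scaled integral of [U_ij] against the [k]-th derivative
    tends to [kappa J_ij m_k], where [kappa < 0] does not depend on [m] because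
    Lebesgue measure is rotation invariant.
    - Second derivatives of a test function commute, so a weak gradient is
      curl-free and the limit is symmetric in [j, k]; hence [J_ij m_k = J_ik m_j]
      and [J = b (x) m] with [b_i = sum_j J_ij m_j].  The integrals do not
      mention the triple, so [b] is a pointwise limit of Borel functions and is
      the same for all triples at [x].
    - As [U] is [BV], the integral whose limit is [kappa b_i] is at most
      [n ^ 2 mu (B (x, 1 / n))] for a finite measure [mu].  A Vitali covering
      argument turns this into [t H^2 (E) <= 64 mu (E)] for Borel [E] inside
      [{limsup > t}], and summing over dyadic [t] gives [b_i] in [L^1 (H^2)]. *)

(* The jump set is not known to be measurable, and a formula for [b] through the traces would
   require a choice of triple at each point. A limit of integrals over all of [Omega] avoids both:
   it is defined everywhere and inherits measurability from Borel approximants. This is why Borel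
   sets have to be shown Carathéodory measurable for [H^2]. The tensor identity itself then holds at
   every jump point.

   The bump is radial because its gradient, integrated over a half-space, transforms like a vector
   under rotations; the normal can thus be moved to a coordinate axis, where reflections kill the
   tangential components.

   The kernel integrals are scaled by [n ^ 3], the inverse volume of a ball. One of these powers is
   the chain-rule factor of the bump gradient, so that [n ^ 2] is left once the derivative has
   passed to the measures: exactly the scaling of [H^2].

   The constant 64 is [8 ^ 2]: a selected sup-norm ball of radius [r] is doubled, the Euclidean
   diameter of the result is at most [8 r], and [pi / 4 <= 1]. *)
Require Import Defs.
From HB Require Import structures.
From mathcomp Require Import all_boot all_order all_algebra perm.
From mathcomp Require Import all_classical all_reals all_analysis.
From mathcomp Require Import measurable_realfun ring lra.
Set Implicit Arguments.
Unset Strict Implicit.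
Unset Printing Implicit Defensive.
Import Order.TTheory GRing.Theory Num.Theory.
Import numFieldNormedType.Exports.
Local Open Scope classical_set_scope.
Local Open Scope ring_scope.

(** * Borel sets of row vectors *)

Section rV_borel.
Context {R : realType} {n : nat}.
Implicit Types (S : set (set 'rV[R]_n)).

Lemma measurable_coord_rV (i : 'I_n) :
  measurable_fun setT (fun x : 'rV[R]_n => x 0 i).
Proof.
move=> _ B mB; rewrite setTI; apply: sub_sigma_algebra.
rewrite -bigcup_seq; exists i => /=; first by rewrite mem_index_enum.
by exists B => //; rewrite setTI.
Qed.

Lemma measurable_fun_rV d (T : measurableType d) (f : T -> 'rV[R]_n) :
  (forall i, measurable_fun setT (fun x => f x 0 i)) -> measurable_fun setT f.
Proof.
move=> mf.
pose G := \big[setU/set0]_(i < n) preimage_set_system setT (@rV_coord R n i) measurable.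
apply: (@measurability _ _ _ _ _ _ G (erefl _)) => _ [B + <-].
rewrite /G -bigcup_seq => -[i _ [A mA <-]]; rewrite !setTI.
by rewrite -comp_preimage -[X in measurable X]setTI; exact: mf.
Qed.

(** An induction principle for Borel sets: open rays generate the Borel sets of the line, and
    coordinate preimages of these generate the rest. It reduces Carathéodory measurability and
    regularity to open coordinate half-spaces. *)
Lemma sigma_algebra_rays S : sigma_algebra setT S ->
  (forall i a, S [set x | a < x 0 i]) -> measurable `<=` S.
Proof.
move=> sS Sray; have [S0 SC SU] := sS.
apply: smallest_sub => // A; rewrite -bigcup_seq => -[i _ [B mB <-]].
rewrite setTI; move: B mB.
suff : (@measurable _ R) `<=` [set B | S (@rV_coord R n i @^-1` B)] by [].
have /= mE : @measurable _ R = _ := RGenOInfty.measurableE R.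
rewrite [X in X `<=` _]mE; apply: smallest_sub.
  split => /=.
  - by rewrite preimage_set0.
  - by move=> C SC'; rewrite setTD preimage_setC -setTD; exact: SC.
  - by move=> F SF; rewrite preimage_bigcup; exact: SU.
move=> _ [a ->] /=.
by rewrite set_itvE; exact: Sray.
Qed.

Lemma measurable_box_rV (A : 'I_n -> set R) : (forall i, measurable (A i)) ->
  measurable [set x : 'rV[R]_n | forall i, A i (x 0 i)].
Proof.
move=> mA; rewrite (_ : [set _ | _] =
  \bigcap_(i in [set: 'I_n]) ((fun x : 'rV[R]_n => x 0 i) @^-1` A i)).
  apply: fin_bigcap_measurable => // i _.
  by rewrite -[X in measurable X]setTI; exact: measurable_coord_rV.
by apply/seteqP; split=> [x xA i _|x xA i]; exact: xA.
Qed.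

Lemma ball_rVE (x : 'rV[R]_n) (r : R) : 0 < r ->
  ball x r = [set y | forall i, `|y 0 i - x 0 i| < r].
Proof.
move=> r0; apply/seteqP; split => y /=.
  by move=> [_ xy] i; rewrite distrC; exact: xy.
move=> xy; split => // i j; rewrite ord1 /ball/= distrC; exact: xy.
Qed.

Lemma measurable_ball_rV (x : 'rV[R]_n) (r : R) : measurable (ball x r).
Proof.
have [r0|r0] := ltP 0 r; last first.
  rewrite (_ : ball _ _ = set0) // -subset0 => y [].
  by rewrite ltNge r0.
rewrite (_ : ball x r = [set y | forall i, ball (x 0 i) r (y 0 i)]).
  by apply: (@measurable_box_rV (fun i => ball (x 0 i) r)) => i;
    apply: open_measurable; exact: ball_open.
by rewrite ball_rVE//; apply/seteqP; split => y /= xy i;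
  move: (xy i); rewrite /ball/= distrC.
Qed.

Lemma ex_rat_ball (x : 'rV[R]_n) (r : R) : 0 < r ->
  exists v : 'rV[rat]_n, ball x r (map_mx ratr v : 'rV[R]_n).
Proof.
move=> r0.
have /choice[v xv] : forall i : 'I_n, exists q : rat, `|ratr q - x 0 i| < r.
  move=> i; have [|q] := @rat_in_itvoo R (x 0 i - r) (x 0 i + r).
    by rewrite ltrD2l (lt_trans _ r0)// oppr_lt0.
  rewrite in_itv/= => /andP[q1 q2]; exists q; rewrite ltr_norml.
  by rewrite ltrBrDl q1 ltrBlDl.
by exists (\row_i v i); rewrite ball_rVE// => i; have := xv i; rewrite !mxE.
Qed.

(** Second countability: an open set is the union of the balls with rational centre and radius
    [1 / (k + 1)] that it contains. *)
Lemma open_measurable_rV (A : set 'rV[R]_n) : open A -> measurable A.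
Proof.
move=> oA.
pose B (p : 'rV[rat]_n * nat) : set 'rV[R]_n :=
  ball (map_mx ratr p.1 : 'rV[R]_n) (p.2.+1%:R^-1).
rewrite (_ : A = \bigcup_(p in [set p | B p `<=` A]) B p).
  rewrite bigcup_mkcond; apply: countable_bigcupT_measurable => // p.
  by case: ifP => // _; exact: measurable_ball_rV.
apply/seteqP; split => [x Ax|x [p pA]]; last exact: pA.
have /nbhs_ballP[e /= e0 xeA] := open_nbhs_nbhs (conj oA Ax).
have e20 : 0 < e / 2 by rewrite divr_gt0.
have [k _ /(_ k (leqnn _)) /= ke] := near_infty_natSinv_lt (PosNum e20).
have k0 : 0 < k.+1%:R^-1 :> R by rewrite invr_gt0.
have [v xv] := ex_rat_ball x k0.
exists (v, k); last exact: ball_sym.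
move=> y vy; apply: xeA; rewrite (splitr e).
by apply: (@ball_triangle _ _ (map_mx ratr v : 'rV[R]_n));
  [exact: le_ball (ltW ke) _ xv|exact: le_ball (ltW ke) _ vy].
Qed.

Lemma continuous_measurable_rV (f : 'rV[R]_n -> R) :
  continuous f -> measurable_fun setT f.
Proof.
move=> cf; apply: (measurability _ (RGenOpens.measurableE R)) => _ [_ [a [b ->] <-]].
rewrite setTI; apply: open_measurable_rV; move/continuousP : cf; apply.
exact: interval_open.
Qed.
End rV_borel.

(** * Invariance of Lebesgue measure *)

Section lebesgue1.
Context {R : realType}.
Local Notation leb := (@lebesgue_measure R).

Lemma measurable_affine (s a : R) : measurable_fun setT (fun z : R => s * z + a)%R.
Proof.
apply: measurable_funD => //.
Qed.

(** By uniqueness of Lebesgue measure it suffices to compare with the rescaled pushforward on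
    half-open intervals. A negative [s] moves the closed end to the other side, whence the two
    cases. *)
Lemma lebesgue_measure_affine (s a : R) (A : set R) : s != 0%R -> measurable A ->
  leb ((fun z => s * z + a)%R @^-1` A) = (`|s|^-1%:E * leb A)%E.
Proof.
move=> s0 mA.
pose k : {nonneg R} := NngNum (normr_ge0 s).
have sn0 : (`|s| != 0)%R by rewrite normr_eq0.
pose f : measurableTypeR R -> measurableTypeR R := fun z => (s * z + a)%R.
have mf : measurable_fun setT f by exact: measurable_affine.
pose m : {measure set (measurableTypeR R) -> \bar R} :=
  mscale k (measure_function_pushforward__canonical__measure_function_Measure leb mf).
have mX X : m X = (`|s|%:E * leb (f @^-1` X))%E by [].
suff mE : forall X, ocitv X -> leb X = m X.
  have /= -> := lebesgue_measure_unique mE mA.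
  by rewrite mX muleA -EFinM mulVf// mul1e.
move=> _ [[x y]] _ <-.
rewrite mX.
have [sp|sn|/eqP] := ltgtP s 0%R; last by rewrite (negbTE s0).
- rewrite (_ : f @^-1` _ = `[(y - a) / s, (x - a) / s[%classic).
    rewrite !lebesgue_measure_itv/= !lte_fin ltr_nM2r ?invr_lt0// ltrD2r.
    case: ifPn => xy; last by rewrite mule0.
    rewrite -EFinD -EFinM ltr0_norm//; congr EFin; field.
    by rewrite lt_eqF.
  apply/seteqP; split => z; rewrite /f /= !in_itv/= => /andP[h1 h2]; apply/andP; split.
  + by rewrite ler_ndivrMr//; lra.
  + by rewrite ltr_ndivlMr//; lra.
  + by move: h2; rewrite ltr_ndivlMr//; lra.
  + by move: h1; rewrite ler_ndivrMr//; lra.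
- rewrite (_ : f @^-1` _ = `](x - a) / s, (y - a) / s]%classic).
    rewrite !lebesgue_measure_itv/= !lte_fin ltr_pM2r ?invr_gt0// ltrD2r.
    case: ifPn => xy; last by rewrite mule0.
    rewrite -EFinD -EFinM gtr0_norm//; congr EFin; field.
    by rewrite gt_eqF.
  apply/seteqP; split => z; rewrite /f /= !in_itv/= => /andP[h1 h2]; apply/andP; split.
  + by rewrite ltr_pdivrMr//; lra.
  + by rewrite ler_pdivlMr//; lra.
  + by move: h1; rewrite ltr_pdivrMr//; lra.
  + by move: h2; rewrite ler_pdivlMr//; lra.
Qed.

End lebesgue1.

Section lebesgue3_invariance.
Context {R : realType}.
Local Notation leb := (@lebesgue_measure R).
Local Notation V := 'rV[R]_3.

Lemma prod_EFin (I : finType) (F : I -> R) :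
  (\prod_i (F i)%:E)%E = (\prod_i F i)%:E.
Proof. by rewrite (big_morph EFin (@EFinM R) (erefl 1%:E)). Qed.

Definition box (A : 'I_3 -> set R) : set V := [set x | forall i, A i (x 0 i)].

Definition cube (k : R) : set V := box (fun=> `]- k, k[%classic).

Lemma forall_ord3 (P : 'I_3 -> Prop) :
  (forall i, P i) <-> [/\ P ord0, P (inord 1) & P ord_max].
Proof.
split=> [Pi|[P0 P1 P2] i]; first by split.
case: i => -[|[|[|//]]] i3.
- by rewrite (_ : Ordinal _ = ord0)//; exact: val_inj.
- by rewrite (_ : Ordinal _ = inord 1)//; apply: val_inj; rewrite /= inordK.
- by rewrite (_ : Ordinal _ = ord_max)//; exact: val_inj.
Qed.

Lemma sum_ord3 (T : nmodType) (F : 'I_3 -> T) :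
  \sum_i F i = F ord0 + F (inord 1) + F ord_max.
Proof.
rewrite !big_ord_recl big_ord0 addr0 addrA; congr (F _ + F _ + F _);
  by apply: val_inj; rewrite /= ?inordK.
Qed.

Lemma vec3E (p : R * R * R) : [/\ vec3 p 0 ord0 = p.1.1,
  vec3 p 0 (inord 1) = p.1.2 & vec3 p 0 ord_max = p.2].
Proof. by split; rewrite mxE//= inordK. Qed.

Lemma lebesgue3_box A : (forall i, measurable (A i)) ->
  lebesgue3 (box A) = (\prod_i leb (A i))%E.
Proof.
move=> mA.
have -> : (\prod_i leb (A i) =
    (leb (A ord0) * leb (A (inord 1))) * leb (A ord_max))%E.
  rewrite !big_ord_recl big_ord0 mule1 muleA; congr (leb (A _) * leb (A _) * leb (A _))%E;
    by apply: val_inj; rewrite /= ?inordK.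
have m01 : measurable (A ord0 `*` A (inord 1)) by exact: measurableX.
have <- : ((leb \x leb) (A ord0 `*` A (inord 1)) =
    leb (A ord0) * leb (A (inord 1)))%E by apply: product_measure1E; exact: mA.
have <- : (((leb \x leb) \x leb) ((A ord0 `*` A (inord 1)) `*` A ord_max) =
    (leb \x leb) (A ord0 `*` A (inord 1)) * leb (A ord_max))%E.
  by apply: product_measure1E => //; exact: mA.
rewrite /lebesgue3 /pushforward; congr (((leb \x leb) \x leb)%E _).
apply/seteqP; split => p; have [p0 p1 p2] := vec3E p.
  by move/forall_ord3 => []; rewrite p0 p1 p2.
by move=> [[? ?] ?]; apply/forall_ord3; rewrite p0 p1 p2.
Qed.

Lemma bigcup_cube : \bigcup_(k : nat) cube k%:R = setT.
Proof.
rewrite -subTset => x _.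
have [k xk] : exists k : nat, forall i, `|x 0 i| < k%:R.
  pose s := \sum_i `|x 0 i|.
  exists (Num.bound s) => i; rewrite (le_lt_trans _ (archi_boundP _))//.
    by rewrite /s (bigD1 i)//= lerDl sumr_ge0.
  by rewrite sumr_ge0.
by exists k => // i /=; rewrite in_itv/= -ltr_norml.
Qed.

(** Boxes are stable under intersection and contain the generating rays, and the cubes exhaust the
    space with finite measure. *)
Lemma box_measure_unique (m1 m2 : {measure set V -> \bar R}) :
  (forall A, (forall i, measurable (A i)) -> m1 (box A) = m2 (box A)) ->
  (forall k, m1 (cube k) < +oo)%E ->
  forall B, measurable B -> m1 B = m2 B.
Proof.
move=> m12 m1oo B mB.
pose G := [set box A | A in [set A | forall i, measurable (A i)]].
pose g (k : nat) := cube k%:R.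
apply: (measure_unique G g) => //.
- apply/seteqP; split.
    apply: sigma_algebra_rays; first exact: smallest_sigma_algebra.
    move=> i a; apply: sub_sigma_algebra.
    exists (fun j => if j == i then `]a, +oo[%classic else setT).
      by move=> j /=; case: ifP.
    apply/seteqP; split => [x /(_ i)/=|x/= ax j].
      by rewrite eqxx /= in_itv/= andbT.
    by case: eqP => [->|//]; rewrite /= in_itv/= ax.
  apply: smallest_sub; first exact: sigma_algebra_measurable.
  by move=> _ [A mA <-]; exact: measurable_box_rV.
- move=> _ _ [A mA <-] [C mC <-]; exists (fun i => A i `&` C i).
    by move=> i; exact: measurableI.
  apply/seteqP; split=> [x xAC|x [xA xC] i]; last by split.
  by split=> i; have [] := xAC i.
- by move=> i; exists (fun=> `]- i%:R, i%:R[%classic).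
- exact: bigcup_cube.
- by move=> _ [A mA <-]; exact: m12.
- by move=> k; exact: m1oo.
Qed.

Lemma lebesgue3_cube (k : R) : 0 < k -> lebesgue3 (cube k) = ((k + k) ^+ 3)%:E.
Proof.
move=> k0; rewrite lebesgue3_box//.
have kk : - k < k by lra.
rewrite (eq_bigr (fun=> (k + k)%:E)).
  by rewrite prod_EFin; congr EFin; rewrite prodr_const card_ord.
by move=> i _; rewrite lebesgue_measure_itv/= lte_fin kk opprK.
Qed.

Lemma lebesgue3_cube_lty (k : R) : (lebesgue3 (cube k) < +oo)%E.
Proof.
apply: (@le_lt_trans _ _ (lebesgue3 (cube (`|k| + 1)))); last first.
  by rewrite lebesgue3_cube ?ltry// ltr_wpDl.
apply: le_measure; rewrite ?inE; [exact: measurable_box_rV..|].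
have := ler_norm k.
by move=> kk x xk i; have := xk i; rewrite /= !in_itv/= => /andP[? ?]; apply/andP; split; lra.
Qed.

(** [c] is the inverse Jacobian of [f]. Stating the change of variables for preimages lets the maps
    be composed without inverting or differentiating them. *)
Definition volume_scaling (c : R) (f : V -> V) :=
  measurable_fun setT f /\
  forall B, measurable B -> lebesgue3 (f @^-1` B) = (c%:E * lebesgue3 B)%E.

Lemma volume_scaling_box (c : R) (f : V -> V) : 0 <= c -> measurable_fun setT f ->
  (forall A, (forall i, measurable (A i)) ->
    lebesgue3 (f @^-1` (box A)) = (c%:E * lebesgue3 (box A))%E) ->
  volume_scaling c f.
Proof.
move=> c0 mf fA; split => // B mB; apply/esym.
pose m1 : {measure set V -> \bar R} := mscale (NngNum c0) lebesgue3.
pose m2 : {measure set V -> \bar R} :=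
  measure_function_pushforward__canonical__measure_function_Measure lebesgue3 mf.
have m1E A : m1 A = (c%:E * lebesgue3 A)%E by [].
have m2E A : m2 A = lebesgue3 (f @^-1` A) by [].
rewrite -m1E -m2E; apply: box_measure_unique => // [A mA|k].
  by rewrite m1E m2E fA.
by rewrite m1E lte_mul_pinfty// lebesgue3_cube_lty.
Qed.

Lemma volume_scaling_comp (c d : R) (f g : V -> V) :
  volume_scaling c f -> volume_scaling d g -> volume_scaling (c * d) (g \o f).
Proof.
move=> [mf fB] [mg gB]; split; first exact: measurableT_comp.
move=> B mB; rewrite comp_preimage fB ?gB ?muleA//.
by rewrite -[X in measurable X]setTI; exact: mg.
Qed.

Lemma volume_scaling_diag (s a : 'I_3 -> R) : (forall i, s i != 0) ->
  volume_scaling (\prod_i `|s i|^-1) (fun x => \row_i (s i * x 0 i + a i)).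
Proof.
move=> s0; apply: volume_scaling_box.
- by apply: prodr_ge0 => i _; rewrite invr_ge0.
- apply: measurable_fun_rV => i; under eq_fun do rewrite mxE.
  apply: measurable_funD => //; apply: measurable_funM => //.
  exact: measurable_coord_rV.
- move=> A mA.
  rewrite (_ : _ @^-1` _ = box (fun i => (fun z => s i * z + a i) @^-1` A i)).
    rewrite !lebesgue3_box//.
      rewrite (eq_bigr (fun i => (`|s i|^-1%:E * leb (A i))%E)).
        by rewrite big_split/= prod_EFin.
      by move=> i _; rewrite lebesgue_measure_affine.
    move=> i; by by rewrite -[X in measurable X]setTI; apply: measurable_affine => // => //.
  by apply/seteqP; split => x xA i; have := xA i; rewrite /= mxE.
Qed.

Lemma volume_scaling_perm (s : 'S_3) :
  volume_scaling 1 (fun x => \row_i x 0 (s i)).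
Proof.
apply: volume_scaling_box => //.
  apply: measurable_fun_rV => i; under eq_fun do rewrite mxE.
  exact: measurable_coord_rV.
move=> A mA; rewrite mul1e.
rewrite (_ : _ @^-1` _ = box (fun i => A ((s^-1)%g i))).
  rewrite !lebesgue3_box// (reindex_inj (@perm_inj _ s)).
  by apply: eq_bigr => i _; rewrite permK.
apply/seteqP; split => x xA i /=; last first.
  by have := xA (s i); rewrite mxE permK.
by have := xA ((s^-1)%g i); rewrite /= mxE permKV.
Qed.

(** Fubini: on the fibre over the first two coordinates the shear is the translation by [t * p.1],
    which preserves the length of each section. *)
Lemma volume_scaling_shear (t : R) :
  volume_scaling 1 (fun x => \row_i (x 0 i + (if i == ord_max then t * x 0 ord0 else 0))).
Proof.
have mF : measurable_fun setT (fun x : V => \row_i (x 0 i + (if i == ord_max then t * x 0 ord0 else 0))).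
  apply: measurable_fun_rV => i; under eq_fun do rewrite mxE.
  apply: measurable_funD; first exact: measurable_coord_rV.
  have [_|_] := eqVneq i ord_max => //=; apply: measurable_funM => //; exact: measurable_coord_rV.
split => // B mB; rewrite mul1e.
rewrite /lebesgue3 /pushforward; apply: (@eq_integral _ _ _ (leb \x leb)%E) => p _ /=.
transitivity (leb ((fun z : R => 1 * z + t * p.1) @^-1`
    xsection (vec3 @^-1` B) p)).
  have E z : \row_i (vec3 (p, z) 0 i +
      (if i == ord_max then t * vec3 (p, z) 0 ord0 else 0)) = vec3 (p, 1 * z + t * p.1).
    have [v0 v1 v2] := vec3E (p, z); have [w0 w1 w2] := vec3E (p, 1 * z + t * p.1).
    apply/rowP; apply/forall_ord3; split; rewrite mxE.
    - by rewrite v0 w0 addr0.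
    - by rewrite v1 w1 ifF ?addr0//; apply/negbTE/eqP => /(congr1 val); rewrite /= inordK.
    - by rewrite eqxx v0 v2 w2 mul1r.
  by congr (leb _); apply/seteqP; split => z; rewrite /xsection /= !inE /= E.
rewrite lebesgue_measure_affine ?normr1 ?invr1 ?mul1e ?oner_neq0//.
apply: measurable_xsection; rewrite -[X in measurable X]setTI.
exact: measurable_vec3.
Qed.
End lebesgue3_invariance.

Section rotations.
Context {R : realType}.
Local Notation V := 'rV[R]_3.
Implicit Types x y nu : V.
Local Notation x0 x := (x 0 ord0).
Local Notation x1 x := (x 0 (inord 1)).
Local Notation x2 x := (x 0 ord_max).

Lemma eq_vec3 x (p : R * R * R) : x0 x = p.1.1 -> x1 x = p.1.2 -> x2 x = p.2 ->
  x = vec3 p.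
Proof.
by have [h0 h1 h2] := vec3E p => a0 a1 a2; apply/rowP/forall_ord3; rewrite h0 h1 h2.
Qed.

Lemma dotvE x y : dotv x y = x0 x * x0 y + x1 x * x1 y + x2 x * x2 y.
Proof. by rewrite /dotv sum_ord3. Qed.

Lemma inord1_neq0 : (inord 1 : 'I_3) != ord0.
Proof. by rewrite -val_eqE /= inordK. Qed.

Lemma inord1_neq_max : (inord 1 : 'I_3) != ord_max.
Proof. by rewrite -val_eqE /= inordK. Qed.

Lemma volume_swap02 : volume_scaling 1 (fun x => vec3 (x2 x, x1 x, x0 x)).
Proof.
have := volume_scaling_perm (R := R) (tperm ord0 ord_max).
congr volume_scaling; apply/funext => x; apply: eq_vec3; rewrite mxE /=.
- by rewrite tpermL.
- by rewrite tpermD// eq_sym ?inord1_neq0 ?inord1_neq_max.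
- by rewrite tpermR.
Qed.

Lemma volume_swap12 : volume_scaling 1 (fun x => vec3 (x0 x, x2 x, x1 x)).
Proof.
have := volume_scaling_perm (R := R) (tperm (inord 1) ord_max).
congr volume_scaling; apply/funext => x; apply: eq_vec3; rewrite mxE /=.
- by rewrite tpermD ?inord1_neq0.
- by rewrite tpermL.
- by rewrite tpermR.
Qed.

Lemma volume_shear t : volume_scaling 1 (fun x => vec3 (x0 x, x1 x, x2 x + t * x0 x)).
Proof.
have := volume_scaling_shear t; congr volume_scaling.
apply/funext => x; apply: eq_vec3; rewrite mxE /=.
- by rewrite addr0.
- by rewrite ifN ?inord1_neq_max ?addr0.
- by rewrite ?eqxx.
Qed.

Lemma volume_comp (f g : V -> V) :
  volume_scaling 1 f -> volume_scaling 1 g -> volume_scaling 1 (g \o f).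
Proof. by move=> vf /(volume_scaling_comp vf); rewrite mulr1. Qed.

(* A plane rotation is a product of three shears. *)
Lemma volume_rot02 (p q : R) : p ^+ 2 + q ^+ 2 = 1 -> p != -1 ->
  volume_scaling 1 (fun x => vec3 (p * x0 x - q * x2 x, x1 x, q * x0 x + p * x2 x)).
Proof.
(* With [p] and [q] the cosine and sine of an angle, [a] is the tangent of half that angle; the
   excluded value [p = -1] is the half turn, where it is infinite. *)
move=> pq1 pN1; pose a := q / (1 + p).
have p1 : 1 + p != 0 by rewrite addrC -[1]opprK subr_eq0.
have := volume_comp (volume_comp (volume_comp (volume_shear a) volume_swap02)
  (volume_comp (volume_shear (- q)) volume_swap02)) (volume_shear a).
congr volume_scaling; apply/funext => x /=.
have E (s : R * R * R) : (vec3 s 0 ord0 = s.1.1) * (vec3 s 0 (inord 1) = s.1.2) * (vec3 s 0 ord_max = s.2).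
  by have [-> -> ->] := vec3E s.
rewrite !E /=.
have aq : 1 - a * q = p.
  rewrite /a; apply: (mulfI p1); rewrite mulrBr mulr1.
  rewrite (_ : (1 + p) * (q / (1 + p) * q) = q ^+ 2); last by field.
  have -> : q ^+ 2 = 1 - p ^+ 2 by rewrite -pq1; ring.
  by ring.
have ap : a * (1 + p) = q by rewrite /a divfK.
apply: eq_vec3; rewrite E /=.
- by rewrite -aq; ring.
- by [].
- have -> : x2 x + a * x0 x + a * (x0 x + - q * (x2 x + a * x0 x)) =
     (1 - a * q) * x2 x + a * (1 + (1 - a * q)) * x0 x by ring.
  by rewrite aq ap addrC.
Qed.

Definition isometry (f : V -> V) :=
  volume_scaling 1 f /\ forall x y, dotv (f x) (f y) = dotv x y.

(** Two plane rotations: one in the first two coordinates cancels the second component of [nu], then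
    one in the first and last coordinates cancels the third. *)
Lemma rotate_to_axis nu : dotv nu nu = 1 ->
  exists2 f, isometry f & exists2 s, s ^+ 2 = 1 & f nu = vec3 (s, 0, 0).
Proof.
have E (s : R * R * R) : (vec3 s 0 ord0 = s.1.1) * (vec3 s 0 (inord 1) = s.1.2) * (vec3 s 0 ord_max = s.2).
  by have [-> -> ->] := vec3E s.
set a := x0 nu; set b := x1 nu; set c := x2 nu.
rewrite dotvE -/a -/b -/c => nu1.
pose rho := Num.sqrt (a ^+ 2 + b ^+ 2).
have rho0 : 0 <= rho by exact: sqrtr_ge0.
have rho2 : rho ^+ 2 = a ^+ 2 + b ^+ 2 by rewrite sqr_sqrtr// addr_ge0 ?sqr_ge0.
(* The image is allowed to be either unit vector of the axis: with this sign the cosines [p] and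
   [rho] of both rotations are nonnegative, which keeps them away from the half turn. *)
pose s : R := if 0 <= a then 1 else -1.
have s2 : s ^+ 2 = 1 by rewrite /s; case: ifP => _; rewrite ?sqrrN expr1n.
have sa : 0 <= s * a.
  by rewrite /s; have [a0|a0] := leP 0 a; [rewrite mul1r|rewrite mulN1r oppr_ge0 ltW].
have [p [q [p0 pq1 h1 h2]]] : exists p q, [/\ 0 <= p, p ^+ 2 + q ^+ 2 = 1,
    p * a - q * b = s * rho & q * a + p * b = 0].
  have [r0|r0] := eqVneq rho 0.
    exists 1, 0; have /eqP : a ^+ 2 + b ^+ 2 = 0 by rewrite -rho2 r0 expr0n.
    rewrite paddr_eq0 ?sqr_ge0// !sqrf_eq0 => /andP[/eqP a0 /eqP b0].
    by rewrite a0 b0 r0; split; rewrite ?ler01//; ring.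
  exists (s * a / rho), (- (s * b / rho)); split.
  - by rewrite divr_ge0.
  - have -> : (s * a / rho) ^+ 2 + (- (s * b / rho)) ^+ 2 = s ^+ 2 * (a ^+ 2 + b ^+ 2) / rho ^+ 2 by field.
    by rewrite s2 -rho2 mul1r divff// sqrf_eq0.
  - have -> : s * a / rho * a - - (s * b / rho) * b = s * (a ^+ 2 + b ^+ 2) / rho by field.
    by rewrite -rho2; field.
  - by field.
pose f1 x : V := vec3 (p * x0 x - q * x1 x, q * x0 x + p * x1 x, x2 x).
have v1 : volume_scaling 1 f1.
  have pN1 : p != -1 by rewrite gt_eqF// (lt_le_trans _ p0)// ltrN10.
  have := volume_comp volume_swap12 (volume_comp (volume_rot02 pq1 pN1) volume_swap12).
  by congr volume_scaling; apply/funext => x /=; rewrite /f1 !E.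
pose f2 x : V := vec3 (rho * x0 x - (- (s * c)) * x2 x, x1 x, - (s * c) * x0 x + rho * x2 x).
have rc1 : rho ^+ 2 + (- (s * c)) ^+ 2 = 1.
  by rewrite sqrrN exprMn s2 rho2 mul1r -nu1; ring.
have v2 : volume_scaling 1 f2.
  by apply: volume_rot02 => //; rewrite gt_eqF// (lt_le_trans _ rho0)// ltrN10.
exists (f2 \o f1).
  split; first exact: volume_comp.
  move=> x y; rewrite !dotvE /= /f2 /f1 !E /=.
  set r := - (s * c) in rc1 *.
  set x0' := x 0 ord0; set x1' := x 0 (inord 1); set x2' := x 0 ord_max.
  set y0' := y 0 ord0; set y1' := y 0 (inord 1); set y2' := y 0 ord_max.
  transitivity ((rho ^+ 2 + r ^+ 2) * ((p * x0' - q * x1') * (p * y0' - q * y1') + x2' * y2')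
    + (q * x0' + p * x1') * (q * y0' + p * y1')); first by ring.
  rewrite rc1; transitivity ((p ^+ 2 + q ^+ 2) * (x0' * y0' + x1' * y1') + x2' * y2'); first by ring.
  by rewrite pq1; ring.
exists s => //; rewrite /= /f2 /f1 !E /= -/a -/b -/c.
apply: eq_vec3; rewrite E /= ?h1 ?h2//.
- have -> : rho * (s * rho) - - (s * c) * c = s * (rho ^+ 2 + c ^+ 2) by ring.
  by rewrite rho2 -[RHS]mulr1 -nu1; congr (s * _); ring.
- have -> : - (s * c) * (s * rho) + rho * c = (1 - s ^+ 2) * (rho * c) by ring.
  by rewrite s2 subrr mul0r.
Qed.

Lemma volume_scaling_dilation (r : R) (a : V) : 0 < r ->
  volume_scaling (r ^- 3) (fun x => r *: (x - a)).
Proof.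
move=> r0; have := @volume_scaling_diag R (fun=> r) (fun i => - r * a 0 i) (fun=> lt0r_neq0 r0).
rewrite prodr_const card_ord gtr0_norm// exprVn; congr volume_scaling.
by apply/funext => x; apply/rowP => i; rewrite !mxE; ring.
Qed.

End rotations.

(** * Smooth radial bumps *)

Section flat_function.
Context {R : realType}.
Implicit Types (t : R) (m : nat).

(** For [m = 0] this is the classical smooth function that is flat at 0. The negative powers of [t]
    are included so that derivatives remain linear combinations of members of the family. *)
Definition flat m t : R := if 0 < t then t^-1 ^+ m * expR (- t^-1) else 0.

Lemma flat_le0 m t : t <= 0 -> flat m t = 0.
Proof. by move=> t0; rewrite /flat ltNge t0. Qed.

Lemma flat_gt0 m t : 0 < t -> 0 < flat m t.
Proof. by move=> t0; rewrite /flat t0 mulr_gt0 ?expR_gt0// exprn_gt0// invr_gt0. Qed.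

Lemma flat_ge0 m t : 0 <= flat m t.
Proof. by have [/flat_gt0/ltW//|/flat_le0->] := ltP 0 t. Qed.

(** A single term of the exponential series at [1 / t] gives the bound. The case [k = 0] bounds the
    function; [k = 2] gives differentiability at 0. *)
Lemma flat_le k m t : flat m t <= (m + k)`!%:R * `|t| ^+ k.
Proof.
have [t0|/flat_le0->] := ltP 0 t; last by rewrite mulr_ge0// exprn_ge0.
rewrite /flat t0 gtr0_norm// expRN ler_pdivrMr ?expR_gt0//.
have : t^-1 ^+ (m + k) / (m + k)`!%:R <= expR t^-1.
  have := @expR_ge1Dxn R t^-1 (m + k).-1; rewrite invr_ge0 => /(_ (ltW t0)).
  case: (m + k)%N => [_|n /= h]; first
    by rewrite fact0 divr1 expr0 (le_trans _ (expR_ge1Dx _))// lerDl invr_ge0 ltW.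
  by rewrite (le_trans _ h)// lerDr.
have f0 : 0 < (m + k)`!%:R :> R by rewrite ltr0n fact_gt0.
rewrite ler_pdivrMr// exprD => h.
have := ler_wpM2r (exprn_ge0 k (ltW t0)) h.
rewrite -mulrA -exprMn mulVf ?gt_eqF// expr1n mulr1 => /le_trans; apply.
by rewrite le_eqVlt; apply/orP; left; apply/eqP; ring.
Qed.

Lemma flat_bounded m t : flat m t <= m`!%:R.
Proof. by have := flat_le 0 m t; rewrite addn0 expr0 mulr1. Qed.

Lemma is_derive_flat m t :
  is_derive t 1 (flat m) (flat m.+2 t - m%:R * flat m.+1 t).
Proof.
have [t0|t0|t0] := ltgtP t 0.
- rewrite !flat_le0 ?(ltW t0)// mulr0 subr0.
  have nE : \near t, cst 0 t = flat m t.
    near=> s; rewrite flat_le0//.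
    by apply: ltW; near: s; exact: lt_nbhsl.
  by apply: (near_eq_is_derive nE); exact: is_derive_cst.
- have nE : \near t, t^-1 ^+ m * expR (- t^-1) = flat m t.
    near=> s; rewrite /flat ifT//.
    by near: s; exact: lt_nbhsr.
  apply: (near_eq_is_derive nE).
  have dV : is_derive t 1 (fun s : R => s^-1) (- t ^- 2).
    have := @is_deriveV R id t 1 1 (lt0r_neq0 t0) (is_derive_id _ _).
    by rewrite /GRing.scale/= mulr1.
  have dE : is_derive t 1 (fun s : R => expR (- s^-1)) (expR (- t^-1) * t ^- 2).
    have := @is_derive1_comp R expR (fun s => - s^-1) t _ _ (is_derive_expR _) (is_deriveN dV).
    by rewrite opprK.
  rewrite /flat t0; case: m {nE} => [|m].
    rewrite (_ : (fun s => _) = fun s => expR (- s^-1)); last by apply/funext => s; rewrite expr0 mul1r.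
    by rewrite mul0r subr0 mulrC exprVn.
  have := is_deriveM (is_deriveX m.+1 dV) dE.
  rewrite (_ : _ * _ = fun s => s^-1 ^+ m.+1 * expR (- s^-1)); last first.
    by apply/funext => s /=; rewrite /GRing.mul/= exprfctE.
  rewrite (_ : _ + _ = t^-1 ^+ m.+3 * expR (- t^-1) -
     m.+1%:R * (t^-1 ^+ m.+2 * expR (- t^-1)))//.
  rewrite /GRing.scale/= exprfctE !exprS.
  by field; exact: lt0r_neq0.
- rewrite t0 !flat_le0// mulr0 subr0.
  have lim0 : (fun h : R => h^-1 *: ((flat m \o shift 0) (h *: 1) - flat m 0)) @ 0^' --> (0:R).
    apply/cvgrPdist_le => /= e e0; near=> h.
    have h0 : h != 0 by near: h; exact: nbhs_dnbhs_neq.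
    rewrite sub0r normrN addr0 (flat_le0 m (lexx 0)) subr0 /GRing.scale/= mulr1.
    rewrite normrM normfV (ger0_norm (flat_ge0 _ _)) mulrC ler_pdivrMr ?normr_gt0//.
    (* The quadratic bound leaves one factor [h] after division, so the difference quotient at 0
       tends to 0. *)
    rewrite (le_trans (flat_le 2 m h))// expr2 mulrA ler_wpM2r//.
    rewrite -ler_pdivlMl ?ltr0n ?fact_gt0//.
    near: h; apply: dnbhs0_le; by rewrite mulr_gt0// invr_gt0 ltr0n fact_gt0.
  split; first by apply/cvg_ex; exists 0.
  exact/cvg_lim.
Unshelve. all: by end_near. Qed.

End flat_function.

Section line.
Context {R : realType} {V W : normedModType R}.

(** The two difference quotients coincide, so that one-variable rules compute directional
    derivatives. *)
Lemma is_derive_line (f : V -> W) (x v : V) (d : W) :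
  is_derive (0 : R) 1 (fun h : R => f (h *: v + x)) d -> is_derive x v f d.
Proof.
move=> [fd <-].
have E : (fun h : R => h^-1 *: (((fun h : R => f (h *: v + x)) \o shift 0) (h *: 1) - f (0 *: v + x)))
  = (fun h => h^-1 *: ((f \o shift x) (h *: v) - f x)).
  by apply/funext => h /=; rewrite scale0r add0r addr0 [h *: 1]mulr1.
by split; [move: fd; rewrite /derivable E|rewrite /derive E].
Qed.
End line.

Section bump.
Context {R : realType}.
Local Notation V := 'rV[R]_3.
Variables (N : R) (c : V).

Lemma continuous_add (f g : V -> R) : continuous f -> continuous g ->
  continuous (fun y => f y + g y).
Proof. by move=> cf cg y; exact: (continuousD (cf y) (cg y)). Qed.

Lemma continuous_mul (f g : V -> R) : continuous f -> continuous g ->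
  continuous (fun y => f y * g y).
Proof. by move=> cf cg y; exact: (continuousM (cf y) (cg y)). Qed.

Definition bump m (y : V) : R := flat m (1 - N ^+ 2 * dotv (y - c) (y - c)).

(* Stability under partial derivatives makes the functions below smooth; all of
   them vanish off the ball of radius [1 / N] around [c]. *)
Inductive bumpy : (V -> R) -> Prop :=
| bumpy_bump m : bumpy (bump m)
| bumpy_coord j f : bumpy f -> bumpy (fun y => (y 0 j - c 0 j) * f y)
| bumpy_add f g : bumpy f -> bumpy g -> bumpy (fun y => f y + g y)
| bumpy_scale a f : bumpy f -> bumpy (fun y => a * f y).

Lemma continuous_flat m : continuous (@flat R m).
Proof.
move=> t; apply: differentiable_continuous; apply/derivable1_diffP.
by case: (is_derive_flat m t).
Qed.

Lemma continuous_coord (j : 'I_3) : continuous (fun y : V => y 0 j).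
Proof. exact: coord_continuous. Qed.

Lemma continuous_coordB j : continuous (fun y : V => y 0 j - c 0 j).
Proof. by move=> y; apply: continuousB; [exact: continuous_coord|exact: cst_continuous]. Qed.

Lemma continuous_dotvB : continuous (fun y : V => dotv (y - c) (y - c)).
Proof.
pose d j (y : V) := y 0 j - c 0 j.
rewrite (_ : (fun y => _) = fun y : V => d ord0 y * d ord0 y +
    d (inord 1) y * d (inord 1) y + d ord_max y * d ord_max y); last first.
  by apply/funext => y; rewrite dotvE /d !mxE.
apply: continuous_add; [apply: continuous_add|];
  by apply: continuous_mul; exact: continuous_coordB.
Qed.

Lemma continuous_bump m : continuous (bump m).
Proof.
move=> y; apply: (@continuous_comp _ _ _ (fun y : V => 1 - N ^+ 2 * dotv (y - c) (y - c)) (flat m)).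
  apply: continuousB; first exact: cst_continuous.
  by apply: continuous_mul; [move=> z; exact: cst_continuous|exact: continuous_dotvB].
exact: continuous_flat.
Qed.

Lemma continuous_bumpy f : bumpy f -> continuous f.
Proof.
elim=> [m|j {}f _ cf|{}f g _ cf _ cg|a {}f _ cf].
- exact: continuous_bump.
- by apply: continuous_mul => //; exact: continuous_coordB.
- exact: continuous_add.
- by apply: continuous_mul => // y; exact: cst_continuous.
Qed.

Lemma is_derive_coordB i j (y : V) :
  is_derive y (delta_mx 0 j) (fun y : V => y 0 i - c 0 i) (i == j)%:R.
Proof.
apply: is_derive_line.
rewrite (_ : (fun h : R => _) = fun h => (i == j)%:R * h + (y 0 i - c 0 i)); last first.
  by apply/funext => h; rewrite !mxE eqxx /= eq_sym; ring.
apply: is_derive_eq.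
by rewrite /GRing.scale/=; ring.
Qed.

Definition dbump m j (y : V) : R := - (2 * N ^+ 2) * ((y 0 j - c 0 j) *
  (bump m.+2 y + - m%:R * bump m.+1 y)).

Lemma is_derive_bump m j (y : V) :
  is_derive y (delta_mx 0 j) (bump m) (dbump m j y).
Proof.
apply: is_derive_line; rewrite /bump.
pose w := y 0 j - c 0 j; pose q := dotv (y - c) (y - c).
rewrite (_ : (fun h : R => _) = fun h => flat m (1 - N ^+ 2 * (q + 2 * w * h + h * h))); last first.
  apply/funext => h; congr (flat m (1 - _ * _)).
  transitivity (\sum_i ((y - c) 0 i * (y - c) 0 i + (h *+ 2 * (y - c) 0 i + h * h) *+ (i == j))).
    apply: eq_bigr => i _; rewrite !mxE eqxx /=; case: (i == j); rewrite ?mulr1n ?mulr0n; ring.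
  rewrite big_split /= -/(dotv _ _) -/q -addrA; congr (_ + _).
  rewrite (bigD1 j)//= big1 ?addr0 ?eqxx => [|i /negbTE ->]; last by rewrite mulr0n.
  by rewrite mulr1n !mxE /w; ring.
pose u h : R := 1 - N ^+ 2 * (q + 2 * w * h + h * h).
have du : is_derive (0 : R) 1 u (- (N ^+ 2 * (2 * w))).
  apply: is_derive_eq.
  by rewrite /GRing.scale/=; ring.
have := @is_derive1_comp R (flat m) u 0 _ _ (is_derive_flat m (u 0)) du.
have -> : u 0 = 1 - N ^+ 2 * q by rewrite /u; ring.
move=> /is_derive_eq; apply; rewrite /dbump /bump -/q -/w; ring.
Qed.

Lemma bumpy_dbump m j : bumpy (dbump m j).
Proof.
rewrite /dbump; apply: bumpy_scale; apply: bumpy_coord; apply: bumpy_add.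
  exact: bumpy_bump.
by apply: bumpy_scale; exact: bumpy_bump.
Qed.

Lemma is_derive_bumpy f j : bumpy f ->
  exists2 g, bumpy g & forall y : V, is_derive y (delta_mx 0 j) f (g y).
Proof.
elim=> [m|i {}f bf [g bg fg]|f1 f2 _ [g1 bg1 fg1] _ [g2 bg2 fg2]|a {}f bf [g bg fg]].
- by exists (dbump m j); [exact: bumpy_dbump|move=> y; exact: is_derive_bump].
- exists (fun y : V => (y 0 i - c 0 i) * g y + (i == j)%:R * f y).
    by apply: bumpy_add; [exact: bumpy_coord|exact: bumpy_scale].
  move=> y; apply: is_derive_eq; first exact: (is_deriveM (is_derive_coordB i j y) (fg y)).
  by rewrite /GRing.scale/= [X in _ + X]mulrC.
- exists (fun y => g1 y + g2 y); first exact: bumpy_add.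
  by move=> y; exact: (is_deriveD (fg1 y) (fg2 y)).
- exists (fun y => a * g y); first exact: bumpy_scale.
  by move=> y; exact: (is_deriveZ a (fg y)).
Qed.

Lemma Ck_bumpy k f : bumpy f -> Ck k f.
Proof.
elim: k f => [|k IH] f bf; split=> //; try exact: continuous_bumpy.
move=> j; have [g bg fg] := is_derive_bumpy j bf.
split=> [y|]; first by case: (fg y).
rewrite (_ : partial j f = g); first exact: IH.
by apply/funext => y; case: (fg y).
Qed.

Lemma bumpy_out f y : bumpy f -> 1 <= N ^+ 2 * dotv (y - c) (y - c) -> f y = 0.
Proof.
move=> + cy; elim=> [m|j {}f _ f0|{}f g _ f0 _ g0|a {}f _ f0].
- by rewrite /bump flat_le0// subr_le0.
- by rewrite f0 mulr0.
- by rewrite f0 g0 addr0.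
- by rewrite f0 mulr0.
Qed.

Lemma test_bumpy Omega f : bumpy f -> 0 < N ->
  [set y | N ^+ 2 * dotv (y - c) (y - c) <= 1] `<=` Omega -> test_function Omega f.
Proof.
move=> bf N0 BO; pose B := [set y : V | N ^+ 2 * dotv (y - c) (y - c) <= 1].
have cB : closed B.
  apply: (@closed_comp _ _ (fun y : V => N ^+ 2 * dotv (y - c) (y - c)) [set x | x <= 1]).
    by move=> y _; apply: continuous_mul; [move=> z; exact: cst_continuous|exact: continuous_dotvB].
  exact: closed_le.
have sB : support_of f `<=` B.
  rewrite [B](closure_id _).1//; apply: closure_subset => y /=; apply: contraNle => h.
  by rewrite (bumpy_out bf)// ltW.
split; first by move=> k; exact: Ck_bumpy.
- apply: bounded_closed_compact; last exact: closed_closure.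
  exists (`|c| + N^-1); split; first exact: num_real.
  move=> M cM y /sB; rewrite /B /= => yc.
  rewrite (le_trans _ (ltW cM))//.
  rewrite -(subrK c y) addrC (le_trans (ler_normD _ _))// lerD2l.
  rewrite [leLHS]/Num.norm/= mx_normrE; apply/bigmax_leP; split; first by rewrite invr_ge0 ltW.
  move=> [i j] _ /=; rewrite ord1.
  rewrite -[leRHS]div1r ler_pdivlMr// -[leLHS]ger0_norm ?mulr_ge0 ?(ltW N0)//.
  rewrite -(@ler_pXn2r _ 2) ?nnegrE// expr1n normrM exprMn normr_id.
  rewrite (le_trans _ yc)// mulrC (gtr0_norm N0) ler_wpM2l ?sqr_ge0//.
  rewrite real_normK ?num_real// /dotv (bigD1 j)//= expr2 lerDl sumr_ge0// => k _.
  by rewrite -expr2 sqr_ge0.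
- exact: subset_trans BO.
Qed.
End bump.

(** * Half-space integrals of the bump gradient *)

Section change_of_variables.
Context {R : realType}.
Local Notation V := 'rV[R]_3.

Lemma ge0_integral_volume_scaling (c : R) (f : V -> V) D (F : V -> \bar R) :
  0 <= c -> volume_scaling c f -> measurable D -> measurable_fun D F ->
  (forall x, D x -> 0 <= F x)%E ->
  (\int[lebesgue3]_(x in f @^-1` D) F (f x) = c%:E * \int[lebesgue3]_(x in D) F x)%E.
Proof.
move=> c0 [mf fB] mD mF F0.
rewrite -(ge0_integral_mscale _ mD (NngNum c0))//.
transitivity (\int[pushforward lebesgue3 f]_(x in D) F x)%E.
  by apply/esym; apply: (@ge0_integral_pushforward _ _ _ _ _ f mf lebesgue3) => // x /[!inE]; exact: F0.
by apply: eq_measure_integral => A mA _; exact: fB.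
Qed.

Lemma integrable_volume_scaling (c : R) (f : V -> V) D (F : V -> R) :
  0 <= c -> volume_scaling c f -> measurable D ->
  lebesgue3.-integrable D (EFin \o F) ->
  lebesgue3.-integrable (f @^-1` D) (EFin \o F \o f).
Proof.
move=> c0 vf mD /integrableP[mF iF].
have mf := vf.1.
apply/integrableP; split.
  move=> mfD B mB.
  rewrite (_ : _ `&` _ = setT `&` f @^-1` (D `&` (EFin \o F) @^-1` B)); last by rewrite setTI.
  by apply: mf => //; exact: mF.
rewrite (ge0_integral_volume_scaling (F := fun x => `|(EFin \o F) x|%E) c0 vf)//.
  by rewrite lte_mul_pinfty.
exact: measurableT_comp.
Qed.

Lemma Rintegral_volume_scaling (c : R) (f : V -> V) D (F : V -> R) :
  0 <= c -> volume_scaling c f -> measurable D ->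
  lebesgue3.-integrable D (EFin \o F) ->
  \int[lebesgue3]_(x in f @^-1` D) F (f x) = c * \int[lebesgue3]_(x in D) F x.
Proof.
move=> c0 vf mD iF.
have mF := measurable_int _ iF.
rewrite /Rintegral integralE [in RHS]integralE.
have /= Ep := ge0_integral_volume_scaling c0 vf mD (measurable_funepos mF) (fun x _ => funepos_ge0 _ x).
have /= En := ge0_integral_volume_scaling c0 vf mD (measurable_funeneg mF) (fun x _ => funeneg_ge0 _ x).
have fp : (\int[lebesgue3]_(x in D) (EFin \o F)^\+ x)%E \is a fin_num.
  by apply: integrable_fin_num => //; exact: integrable_funepos.
have fn : (\int[lebesgue3]_(x in D) (EFin \o F)^\- x)%E \is a fin_num.
  by apply: integrable_fin_num => //; exact: integrable_funeneg.
rewrite (_ : (fun x => (F (f x))%:E) = (EFin \o F) \o f)//.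
rewrite (_ : ((EFin \o F) \o f)^\+%E = (EFin \o F)^\+%E \o f); last exact: funepos_comp.
rewrite (_ : ((EFin \o F) \o f)^\-%E = (EFin \o F)^\-%E \o f); last exact: funeneg_comp.
rewrite [X in fine (X - _)%E = _]Ep [X in fine (_ - X)%E = _]En.
rewrite -muleBr ?fin_num_adde_defr// fineM//.
by rewrite fin_numB fp.
Qed.
End change_of_variables.

Section half_space.
Context {R : realType}.
Local Notation V := 'rV[R]_3.
Implicit Types (nu z w : V).

(* The [k]-th partial derivative of the radial bump [bump 1 0 0]. *)
Definition ker (k : 'I_3) z : R := - 2 * (z 0 k * flat 2 (1 - dotv z z)).

Definition half_space nu : set V := [set z | 0 < dotv z nu].

Lemma continuous_dotvl nu : continuous (fun z : V => dotv z nu).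
Proof.
rewrite (_ : (fun z => _) = fun z : V => z 0 ord0 * nu 0 ord0 +
  z 0 (inord 1) * nu 0 (inord 1) + z 0 ord_max * nu 0 ord_max); last first.
  by apply/funext => y; rewrite dotvE.
by apply: continuous_add; [apply: continuous_add|];
  apply: continuous_mul; do ?exact: continuous_coord; move=> z; exact: cst_continuous.
Qed.

Lemma measurable_half_space nu : measurable (half_space nu).
Proof.
apply: open_measurable_rV.
rewrite (_ : half_space nu = (fun z => dotv z nu) @^-1` [set x | 0 < x]) //.
by apply: open_comp; [move=> z _; exact: continuous_dotvl|exact: open_gt].
Qed.

Lemma kerE k : ker k = (fun z => (z 0 k - (0 : V) 0 k) * (-2 * bump 1 0 2 z)).
Proof.
by apply/funext => z; rewrite /ker /bump !subr0 expr1n mul1r mxE subr0; ring.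
Qed.

Lemma continuous_ker k : continuous (ker k).
Proof.
rewrite kerE; apply: (@continuous_bumpy R 1 0); apply: bumpy_coord.
by apply: bumpy_scale; exact: bumpy_bump.
Qed.

Lemma ker_out k z : 1 <= dotv z z -> ker k z = 0.
Proof. by move=> z1; rewrite /ker flat_le0 ?mulr0// subr_le0. Qed.

Lemma dotv_ge0 z : 0 <= dotv z z.
Proof. by apply: sumr_ge0 => i _; rewrite -expr2 sqr_ge0. Qed.

Lemma coord_le_dotv z k : (z 0 k) ^+ 2 <= dotv z z.
Proof.
rewrite /dotv (bigD1 k)//= expr2 lerDl sumr_ge0// => i _.
by rewrite -expr2 sqr_ge0.
Qed.

Lemma coord_lt1 z k : dotv z z < 1 -> `|z 0 k| < 1.
Proof.
move=> z1; rewrite -(@ltr_pXn2r _ 2) ?nnegrE// expr1n real_normK ?num_real//.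
exact: le_lt_trans (coord_le_dotv z k) z1.
Qed.

(** Inside the unit ball the factors are at most [2], [1] and [2! = 2]; outside it the kernel
    vanishes. *)
Lemma ker_bounded k z : `|ker k z| <= 4.
Proof.
have [z1|/ker_out->] := ltP (dotv z z) 1; last by rewrite normr0.
rewrite /ker !normrM normrN (@ger0_norm _ 2)// (ger0_norm (flat_ge0 _ _)).
have := flat_bounded 2 (1 - dotv z z); have := coord_lt1 k z1.
have := flat_ge0 2 (1 - dotv z z); have := normr_ge0 (z 0 k).
rewrite (_ : 2`!%:R = 2 :> R)//; nra.
Qed.

Lemma integrable_ker k D : measurable D -> lebesgue3.-integrable D (EFin \o ker k).
Proof.
move=> mD.
have mc : measurable (@cube R 1) by exact: measurable_box_rV.
have mk : measurable_fun setT (ker k) by apply: continuous_measurable_rV; exact: continuous_ker.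
suff : lebesgue3.-integrable setT (EFin \o ker k) by apply: integrableS.
have : lebesgue3.-integrable (@cube R 1) (EFin \o ker k).
  apply: measurable_bounded_integrable => //.
  - exact: lebesgue3_cube_lty.
  - exact: measurable_funS mk.
  - exists 4; split; first exact: num_real.
    by move=> M M4 z _; apply: le_trans (ker_bounded k z) (ltW M4).
move/(integrable_mkcond _ mc); congr (integrable _ _ _).
apply/funext => z; rewrite /patch; case: ifPn => //; rewrite notin_setE => zc /=.
rewrite ker_out// leNgt; apply/negP => z1; apply: zc => i /=.
by rewrite in_itv/= -ltr_norml coord_lt1.
Qed.

Definition kappa : R := \int[lebesgue3]_(z in half_space (vec3 (1, 0, 0))) ker ord0 z.

Lemma dotv_vec3 (p : R * R * R) z :
  dotv z (vec3 p) = z 0 ord0 * p.1.1 + z 0 (inord 1) * p.1.2 + z 0 ord_max * p.2.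
Proof. by rewrite dotvE; have [-> -> ->] := vec3E p. Qed.

Definition reflect_coord (j : 'I_3) z : V := \row_i ((-1) ^+ (i == j) * z 0 i + 0).

Lemma volume_reflect j : volume_scaling 1 (reflect_coord j).
Proof.
have := @volume_scaling_diag R (fun i => (-1) ^+ (i == j)) (fun=> 0) (fun i => negbT (signr_eq0 _ _)).
by rewrite big1// => i _; rewrite normr_sign invr1.
Qed.

Lemma dotv_reflect j z : dotv (reflect_coord j z) (reflect_coord j z) = dotv z z.
Proof.
apply: eq_bigr => i _; rewrite !mxE addr0 mulrACA -expr2 sqrr_sign mul1r//.
Qed.

Lemma ker_reflect j k z : ker k (reflect_coord j z) = (-1) ^+ (k == j) * ker k z.
Proof. by rewrite /ker dotv_reflect !mxE; ring. Qed.

Lemma half_space_reflect j nu :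
  half_space (reflect_coord j nu) = reflect_coord j @^-1` half_space nu.
Proof.
have E z : dotv z (reflect_coord j nu) = dotv (reflect_coord j z) nu.
  by apply: eq_bigr => i _; rewrite !mxE; ring.
by apply/seteqP; split => z; rewrite /half_space/= E.
Qed.

Lemma Rintegral_half_space_reflect j k nu :
  \int[lebesgue3]_(z in half_space (reflect_coord j nu)) ker k z =
  (-1) ^+ (k == j) * \int[lebesgue3]_(z in half_space nu) ker k z.
Proof.
have mH := measurable_half_space nu.
have := Rintegral_volume_scaling ler01 (volume_reflect j) mH (integrable_ker k mH).
rewrite mul1r => <-; rewrite -half_space_reflect -RintegralZl.
- by apply: eq_Rintegral => z _; rewrite ker_reflect mulrA -expr2 sqrr_sign mul1r.
- exact: measurable_half_space.
- rewrite (_ : _ \o _ = (fun z => ((-1) ^+ (k == j))%:E * (ker k z)%:E)%E); last first.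
    by apply/funext => z /=; rewrite ker_reflect EFinM.
  by apply: integrableZl; [exact: measurable_half_space|apply: integrable_ker; exact: measurable_half_space].
Qed.

(** For [k != 0] the reflection of coordinate [k] preserves the half-space and changes the sign of
    the kernel, so the integral equals its own opposite. For [k = 0] and [s = -1], reflecting
    coordinate 0 reduces to the definition of [kappa]. *)
Lemma half_space_axis k s : s ^+ 2 = 1 ->
  \int[lebesgue3]_(z in half_space (vec3 (s, 0, 0))) ker k z = kappa * (vec3 (s, 0, 0)) 0 k.
Proof.
move=> s2; have [v0 v1 v2] := vec3E (s, 0, 0).
have [->|k0] := eqVneq k ord0.
  rewrite v0 /=; move/eqP : s2; rewrite sqrf_eq1 => /orP[]/eqP->; first by rewrite mulr1.
  have -> : vec3 (-1, 0, 0) = reflect_coord ord0 (vec3 (1, 0, 0)) :> V.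
    have [u0 u1 u2] := vec3E (1 : R, 0 : R, 0 : R).
    have [w0 w1 w2] := vec3E (-1 : R, 0 : R, 0 : R).
    by apply/rowP/forall_ord3; rewrite w0 w1 w2; split; rewrite mxE ?u0 ?u1 ?u2/= addr0 ?mulr0 ?mulr1.
  by rewrite Rintegral_half_space_reflect eqxx expr1 mulN1r mulrN1.
have vk : vec3 (s, 0, 0) 0 k = 0.
  by move: k k0; apply/forall_ord3; split => //; rewrite ?v1 ?v2 ?eqxx.
have rE : reflect_coord k (vec3 (s, 0, 0)) = vec3 (s, 0, 0).
  apply/rowP => i; rewrite mxE addr0; have [->|_] := eqVneq i k; first by rewrite vk mulr0.
  by rewrite mul1r.
rewrite vk mulr0; have := Rintegral_half_space_reflect k k (vec3 (s, 0, 0)).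
by rewrite rE eqxx expr1 mulN1r; lra.
Qed.

Lemma dotv_delta k z : dotv (delta_mx 0 k : V) z = z 0 k.
Proof.
rewrite /dotv (bigD1 k)//= big1 => [|i /negbTE ik]; rewrite !mxE ?eqxx ?ik ?mul1r ?addr0//.
by rewrite mul0r.
Qed.

(** The kernel is a scalar radial function times [z]. Since [f] preserves dot products, component
    [k] at [z] is the combination of the components at [f z] with the coordinates of [f e_k];
    integrating leaves [kappa] times the dot product of [f e_k] and [f nu], that is [kappa nu_k]. *)
Lemma half_space_ker k nu : dotv nu nu = 1 ->
  \int[lebesgue3]_(z in half_space nu) ker k z = kappa * nu 0 k.
Proof.
move=> nu1; have [f [vf fd] [s s1 fnu]] := rotate_to_axis nu1.
have hE : half_space nu = f @^-1` half_space (vec3 (s, 0, 0)).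
  by apply/seteqP; split => z; rewrite /half_space/= -fnu fd.
have kE z : ker k z = \sum_j f (delta_mx 0 k) 0 j * ker j (f z).
  rewrite /ker; under eq_bigr do rewrite fd; rewrite -dotv_delta -(fd _ z).
  rewrite /dotv [LHS](_ : _ = (\sum_i f (delta_mx 0 k) 0 i * f z 0 i) *
    (-2 * flat 2 (1 - dotv z z))); last by rewrite /dotv; ring.
  by rewrite mulr_suml; apply: eq_bigr => i _; rewrite /dotv; ring.
have mH := measurable_half_space (vec3 (s, 0, 0)).
have mf : measurable (f @^-1` half_space (vec3 (s, 0, 0))) by rewrite -hE; exact: measurable_half_space.
have ij j := integrable_volume_scaling ler01 vf mH (integrable_ker j mH).
have Ij j : \int[lebesgue3]_(z in f @^-1` half_space (vec3 (s, 0, 0)))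
    (f (delta_mx 0 k) 0 j * ker j (f z)) = f (delta_mx 0 k) 0 j * (kappa * vec3 (s, 0, 0) 0 j).
  by rewrite RintegralZl//; [congr (_ * _); rewrite -half_space_axis// -[RHS]mul1r;
    exact: (Rintegral_volume_scaling ler01 vf mH (integrable_ker j mH))|exact: ij].
have iZ j : lebesgue3.-integrable (f @^-1` half_space (vec3 (s, 0, 0)))
   (EFin \o (fun z => f (delta_mx 0 k) 0 j * ker j (f z))).
  rewrite (_ : _ \o _ = (fun z => (f (delta_mx 0 k) 0 j)%:E * (ker j (f z))%:E)%E).
    by apply: integrableZl => //; exact: ij.
  by apply/funext => z /=; rewrite EFinM.
rewrite hE; under eq_Rintegral do rewrite kE sum_ord3.
rewrite RintegralD// ?RintegralD// ?Ij.
  transitivity (kappa * dotv (f (delta_mx 0 k)) (f nu)).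
    by rewrite fnu dotvE; ring.
  by rewrite fd dotv_delta.
have := integrableD mf (iZ ord0) (iZ (inord 1)).
by congr integrable.
Qed.

Lemma kappa_lt0 : kappa < 0.
Proof.
pose H : set V := half_space (vec3 (1, 0, 0)).
(* The integrand is nonpositive on the half-space, so a box inside it where the integrand is bounded
   away from 0 suffices. On this box [dotv z z < 3/4], hence [flat 2] is at least [exp (- 4)] there,
   and [z_0 > 1/4] gives the bound [- e]. *)
pose B : set V := box (fun=> `]1/4, 1/2[%classic).
have mH : measurable H by exact: measurable_half_space.
have mB : measurable B by exact: measurable_box_rV.
pose e : R := expR (- 4) / 2.
have e0 : 0 < e by rewrite divr_gt0// expR_gt0.
have HE z : H z = (0 < z 0 ord0).
  by rewrite /H /half_space/= dotv_vec3/= mulr1 !mulr0 !addr0.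
have Bk z : B z -> ker ord0 z <= - e.
  move=> /forall_ord3[]; rewrite /= !in_itv/= => /andP[a0 b0] /andP[a1 b1] /andP[a2 b2].
  have zz : dotv z z < 3/4 by rewrite dotvE; nra.
  have fe : expR (- 4) <= flat 2 (1 - dotv z z).
    have t0 : 0 < 1 - dotv z z by lra.
    have zz0 := dotv_ge0 z.
    rewrite /flat t0 -[leLHS]mul1r ler_pM ?expR_ge0//.
      by rewrite exprn_ege1// invf_ge1//; lra.
    rewrite ler_expR lerN2 -[leRHS]invrK lef_pV2 ?posrE ?invr_gt0//; lra.
  rewrite /ker /e; have := expR_gt0 (- 4 : R); nra.
have Hk z : H z -> ker ord0 z <= 0.
  rewrite HE => z0; rewrite /ker; have := flat_ge0 2 (1 - dotv z z); nra.
have vB : lebesgue3 B = (((1 / 4) : R) ^+ 3)%:E.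
  rewrite lebesgue3_box// (eq_bigr (fun=> (1 / 4)%:E)).
    by rewrite prod_EFin prodr_const card_ord.
  move=> i _; rewrite lebesgue_measure_itv/= lte_fin ifT; last by lra.
  by rewrite -EFinD; congr EFin; lra.
have iB : lebesgue3.-integrable H (EFin \o \1_B).
  apply/integrableP; split.
    by apply/measurable_EFinP; exact: measurable_funTS (measurable_indic mB).
  under eq_integral do rewrite gee0_abs ?lee_fin//.
  rewrite integral_indic// (@le_lt_trans _ _ (lebesgue3 B))// ?vB ?ltry//.
  by rewrite -vB; apply: le_measure; rewrite ?inE//; exact: measurableI.
have : kappa <= \int[lebesgue3]_(z in H) (- e * \1_B z).
  apply: le_Rintegral => //; first exact: integrable_ker.
    by rewrite (_ : _ \o _ = (fun z => (- e)%:E * (\1_B z)%:E)%E)//; apply: integrableZl.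
  move=> z Hz; rewrite indicE; have [/set_mem zB|_] := boolP (z \in B).
    by rewrite mulr1 Bk.
  by rewrite mulr0 Hk.
rewrite RintegralZl// /Rintegral integral_indic// setIidl; last first.
  by move=> z /(_ ord0); rewrite HE /= in_itv/= => /andP[z0 _]; lra.
rewrite [X in - e * X](_ : _ = (1 / 4) ^+ 3 :> R); last exact: (congr1 fine vB).
by nra.
Qed.

(** A rotation turns the hyperplane into a box with a one-point side; the extended-real convention
    [0 * oo = 0] absorbs the two infinite sides. *)
Lemma lebesgue3_hyperplane nu : dotv nu nu = 1 ->
  lebesgue3 [set z | dotv z nu = 0] = 0%E.
Proof.
move=> nu1; have [f [vf fd] [s s2 fnu]] := rotate_to_axis nu1.
pose A (i : 'I_3) : set R := if i == ord0 then [set 0] else setT.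
have mA i : measurable (A i) by rewrite /A; case: ifP.
have -> : [set z | dotv z nu = 0] = f @^-1` (box A).
  have s0 : s != 0 by apply/eqP => s0; move: s2; rewrite s0 expr0n/= => /eqP; rewrite eq_sym oner_eq0.
  apply/seteqP; split => z /=; rewrite -(fd z) fnu dotv_vec3/= !mulr0 !addr0.
    move/eqP; rewrite mulf_eq0 (negbTE s0) orbF => /eqP fz i.
    by rewrite /A; case: eqP => [->|].
  by move/(_ ord0); rewrite /A eqxx /= => ->; rewrite mul0r.
rewrite vf.2; last exact: measurable_box_rV.
by rewrite mul1e lebesgue3_box// (bigD1 ord0)//= /A eqxx lebesgue_measure_set1 mul0e.
Qed.
End half_space.

(** * Blow-up at a jump point *)

Section dilation.
Context {R : realType}.
Local Notation V := 'rV[R]_3.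
Implicit Types (nu x y z : V) (n : nat).

Lemma enorm_rV z : enorm z = Num.sqrt (dotv z z).
Proof.
by rewrite /enorm big_ord1.
Qed.

Lemma enorm_lt z (r : R) : 0 < r -> (enorm z < r) = (dotv z z < r ^+ 2).
Proof.
move=> r0; rewrite enorm_rV -{1}(gtr0_norm r0) -sqrtr_sqr ltr_sqrt//.
by rewrite exprn_gt0.
Qed.

Definition dil x n y : V := n.+1%:R *: (y - x).

Lemma volume_dil x n : volume_scaling (n.+1%:R ^- 3) (dil x n).
Proof. exact: volume_scaling_dilation. Qed.

Lemma dotv_dil x n y : dotv (dil x n y) (dil x n y) = n.+1%:R ^+ 2 * dotv (y - x) (y - x).
Proof. by rewrite !dotvE !mxE; ring. Qed.

Lemma dotv_dill x n y nu : dotv (dil x n y) nu = n.+1%:R * dotv (y - x) nu.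
Proof. by rewrite !dotvE !mxE; ring. Qed.

Definition unit_half_ball nu : set V := [set z | dotv z z < 1 /\ 0 < dotv z nu].

Lemma half_ball_dil x nu n :
  half_ball x nu n.+1%:R^-1 = dil x n @^-1` unit_half_ball nu.
Proof.
have n0 : 0 < n.+1%:R :> R by [].
apply/seteqP; split => y; rewrite /half_ball /unit_half_ball/= enorm_lt ?invr_gt0//;
  rewrite dotv_dil dotv_dill pmulr_rgt0// => -[h1 h2]; split => //.
  by rewrite mulrC -ltr_pdivlMr ?exprn_gt0// div1r -exprVn.
by move: h1; rewrite mulrC -ltr_pdivlMr ?exprn_gt0// div1r -exprVn.
Qed.

Lemma measurable_unit_half_ball nu : measurable (unit_half_ball nu).
Proof.
apply: measurableI; last exact: measurable_half_space.
apply: open_measurable_rV.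
rewrite (_ : (fun z : V => _) = (fun z : V => dotv (z - 0) (z - 0)) @^-1` [set t | t < 1]).
  by apply: open_comp; [move=> z _; exact: continuous_dotvB|exact: open_lt].
by apply/funext => z /=; rewrite subr0.
Qed.

Lemma measurable_half_ball x nu n : measurable (half_ball x nu (n.+1%:R^-1 : R)).
Proof.
rewrite half_ball_dil -[X in measurable X]setTI; apply: (volume_dil x n).1 => //.
exact: measurable_unit_half_ball.
Qed.

Lemma lebesgue3_half_ball x nu n : lebesgue3 (half_ball x nu (n.+1%:R^-1 : R)) =
  ((n.+1%:R ^- 3)%:E * lebesgue3 (unit_half_ball nu))%E.
Proof.
by rewrite half_ball_dil (volume_dil x n).2//; exact: measurable_unit_half_ball.
Qed.

Lemma lebesgue3_unit_half_ball_fin nu : lebesgue3 (unit_half_ball nu) \is a fin_num.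
Proof.
rewrite ge0_fin_numE// (le_lt_trans _ (lebesgue3_cube_lty 1))//.
apply: le_measure; rewrite ?inE.
- exact: measurable_unit_half_ball.
- exact: measurable_box_rV.
- by move=> z [z1 _] i; rewrite /= in_itv/= -ltr_norml coord_lt1.
Qed.

Lemma cvg_invSn_at_right : n.+1%:R^-1 @[n --> \oo] --> (0 : R)^'+.
Proof.
move=> A [e /= e0 eA]; have := near_infty_natSinv_lt (PosNum e0).
apply: filterS => n /= ne; apply: eA => /=; rewrite ?invr_gt0//.
by rewrite sub0r normrN gtr0_norm// invr_gt0.
Qed.

(** The half ball of radius [1 / (n + 1)] has volume [v / (n + 1) ^ 3], so multiplying the averages
    by [v] replaces their normalization by the power of [n + 1]. *)
Lemma scaled_trace (U : V -> 'M[R]_3) x nu A :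
  (\forall n \near \oo, measurable_fun (half_ball x nu (n.+1%:R^-1 : R)) (fun y => enorm (U y - A))) ->
  one_sided_trace U x nu A ->
  ((n.+1%:R ^+ 3)%:E * \int[lebesgue3]_(y in half_ball x nu (n.+1%:R^-1 : R)) (enorm (U y - A))%:E)%E
    @[n --> \oo] --> 0%E.
Proof.
move=> mU tr; set v := fine (lebesgue3 (unit_half_ball nu)).
have vE : lebesgue3 (unit_half_ball nu) = v%:E by rewrite fineK// lebesgue3_unit_half_ball_fin.
have v0 : 0 <= v by rewrite fine_ge0.
have trn := cvg_comp _ _ cvg_invSn_at_right tr.
have : (v%:E * ((lebesgue3 (half_ball x nu (n.+1%:R^-1 : R)))^-1 *
   \int[lebesgue3]_(y in half_ball x nu (n.+1%:R^-1 : R)) (enorm (U y - A))%:E))%E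
    @[n --> \oo] --> (v%:E * 0)%E.
  by apply: cvgeZl => //; exact: trn.
rewrite mule0; apply: cvg_trans; apply: near_eq_cvg.
near=> n.
have n0 : n.+1%:R != 0 :> R by [].
have lE : lebesgue3 (half_ball x nu (n.+1%:R^-1 : R)) = (n.+1%:R ^- 3 * v)%:E.
  by rewrite lebesgue3_half_ball vE EFinM.
(* [nu] is arbitrary here and may be 0, which makes the half balls empty; when [v = 0] the integrals
   vanish and the inverse volume is never simplified. *)
have [v00|v00] := eqVneq v 0.
  rewrite v00 mul0e null_set_integral ?mule0//.
  - exact: measurable_half_ball.
  - by apply/measurable_EFinP; near: n.
  - by apply: etrans lE _; rewrite v00 mulr0.
rewrite lE inver mulf_eq0 (negbTE v00) orbF invr_eq0 expf_eq0 (negbTE n0)/=.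
rewrite muleA -EFinM; congr (_%:E * _)%E.
by field; rewrite ?v00 ?nat1r ?natr1 ?n0 ?pnatr_eq0.
Unshelve. all: by end_near. Qed.

End dilation.

Section blowup.
Context {R : realType}.
Local Notation V := 'rV[R]_3.
Implicit Types (nu x y z : V) (n : nat).

(** The closed Euclidean ball of radius [1 / (n + 1)], written without a root to match the support
    condition in [test_bumpy]. *)
Definition shrunk_ball x n : set V :=
  [set y | n.+1%:R ^+ 2 * dotv (y - x) (y - x) <= 1].

Lemma shrunk_ball_coord x n y i : shrunk_ball x n y -> `|y 0 i - x 0 i| <= n.+1%:R^-1.
Proof.
rewrite /shrunk_ball/= => yx; have n0 : 0 < n.+1%:R :> R by [].
rewrite -(@ler_pXn2r _ 2) ?nnegrE ?invr_ge0//.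
rewrite real_normK ?num_real// exprVn -[leRHS]div1r ler_pdivlMr ?exprn_gt0//.
rewrite mulrC (le_trans _ yx)// ler_wpM2l ?exprn_ge0//.
by have := coord_le_dotv (y - x) i; rewrite !mxE.
Qed.

Lemma near_shrunk_ball x (W : set V) : nbhs x W ->
  \forall n \near \oo, shrunk_ball x n `<=` W.
Proof.
move=> /nbhs_ballP[e /= e0 eW]; have := near_infty_natSinv_lt (PosNum e0).
apply: filterS => n /= ne; apply: subset_trans eW => y yx.
rewrite ball_rVE// => i; exact: le_lt_trans (shrunk_ball_coord i yx) ne.
Qed.

Lemma half_ball_shrunk x nu n : half_ball x nu n.+1%:R^-1 `<=` shrunk_ball x n.
Proof.
rewrite half_ball_dil => y [+ _]; rewrite dotv_dil; exact: ltW.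
Qed.

Lemma Rintegral_unit_half_ball k nu :
  \int[lebesgue3]_(z in unit_half_ball nu) ker k z =
  \int[lebesgue3]_(z in half_space nu) ker k z.
Proof.
rewrite [LHS]Rintegral_mkcond [RHS]Rintegral_mkcond; apply: eq_Rintegral => z _.
rewrite /patch; case: ifPn => [/set_mem[_ h]|]; first by rewrite mem_set.
rewrite notin_setE => nz; case: ifPn => // /set_mem hz.
by rewrite ker_out// leNgt; apply/negP => z1; exact: nz.
Qed.

Lemma Rintegral_half_ball_ker x nu n k : dotv nu nu = 1 ->
  \int[lebesgue3]_(y in half_ball x nu n.+1%:R^-1) ker k (dil x n y) =
  n.+1%:R ^- 3 * (kappa * nu 0 k).
Proof.
move=> nu1; rewrite -half_space_ker// -Rintegral_unit_half_ball half_ball_dil.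
have mH := measurable_unit_half_ball nu.
exact: (Rintegral_volume_scaling _ (volume_dil x n) mH (integrable_ker k mH)).
Qed.

Variables (Omega : set V) (U : V -> 'M[R]_3).
Hypothesis Omega_open : open Omega.
Hypothesis iU : forall i j, lebesgue3.-integrable Omega (EFin \o (fun y => U y i j)).

Let mOmega : measurable Omega. Proof. exact: open_measurable_rV. Qed.

Lemma measurable_ker_dil x n k D : measurable_fun D (fun y => ker k (dil x n y)).
Proof.
apply: measurable_funTS; apply: (measurableT_comp (f := ker k)).
  by apply: continuous_measurable_rV; exact: continuous_ker.
exact: (volume_dil x n).1.
Qed.

Lemma integrable_ker_dil x n k nu :
  lebesgue3.-integrable (half_ball x nu n.+1%:R^-1) (EFin \o (fun y => ker k (dil x n y))).
Proof.
have mH := measurable_unit_half_ball nu.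
rewrite half_ball_dil.
exact: (integrable_volume_scaling _ (volume_dil x n) mH (integrable_ker k mH)).
Qed.

Lemma integrable_Mker x n k D (F : V -> R) : measurable D ->
  lebesgue3.-integrable D (EFin \o F) ->
  lebesgue3.-integrable D (EFin \o (fun y => F y * ker k (dil x n y))).
Proof.
move=> mD iF.
have : lebesgue3.-integrable D ((EFin \o F) \* (EFin \o (fun y => ker k (dil x n y))))%E.
  apply: integrableMl => //; first exact: measurable_ker_dil.
  exists 4; split; first exact: num_real.
  by move=> M M4 z _; apply: le_trans (ker_bounded k _) (ltW M4).
by congr integrable; apply/funext => y /=; rewrite EFinM.
Qed.

Lemma measurable_enormB (A : 'M[R]_3) D : measurable D -> D `<=` Omega ->
  measurable_fun D (fun y => enorm (U y - A)).
Proof.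
move=> mD DO; rewrite /enorm.
apply: (measurableT_comp (f := @Num.sqrt R)).
  by apply: continuous_measurable_fun; exact: sqrt_continuous.
apply: measurable_sum => i; apply: measurable_sum => j.
apply: measurable_funX.
under eq_fun do rewrite !mxE.
apply: measurable_funB => //.
by apply: measurable_funS DO _ => //; apply/measurable_EFinP; exact: measurable_int (iU i j).
Qed.

Lemma coord_le_enorm (A : 'M[R]_3) i j : `|A i j| <= enorm A.
Proof.
rewrite /enorm -sqrtr_sqr ler_sqrt; last first.
  by apply: sumr_ge0 => i' _; apply: sumr_ge0 => j' _; rewrite sqr_ge0.
rewrite (bigD1 i)//= (bigD1 j)//= -addrA lerDl addr_ge0//.
  by apply: sumr_ge0 => j' _; rewrite sqr_ge0.
by apply: sumr_ge0 => i' _; apply: sumr_ge0 => j' _; rewrite sqr_ge0.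
Qed.

(** Split [U] into [A] and [U - A]. The constant part has exactly the limit value for every [n], by
    scaling; the remainder is controlled by the bounded kernel and the definition of the trace. *)
Lemma half_blowup x nu A i j k : Omega x -> dotv nu nu = 1 ->
  one_sided_trace U x nu A ->
  n.+1%:R ^+ 3 * \int[lebesgue3]_(y in half_ball x nu n.+1%:R^-1) (U y i j * ker k (dil x n y))
   @[n --> \oo] --> kappa * (A i j * nu 0 k).
Proof.
move=> Ox nu1 tr.
have nO : \forall n \near \oo, half_ball x nu n.+1%:R^-1 `<=` Omega.
  have := near_shrunk_ball (open_nbhs_nbhs (conj Omega_open Ox)).
  by apply: filterS => n; apply: subset_trans; exact: half_ball_shrunk.
have mH n := measurable_half_ball x nu n.
have trn : ((n.+1%:R ^+ 3)%:E * \int[lebesgue3]_(y in half_ball x nu (n.+1%:R^-1 : R)) (enorm (U y - A))%:E)%E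
    @[n --> \oo] --> (0:R)%:E.
  apply: scaled_trace => //; apply: filterS nO => n nO.
  exact: measurable_enormB.
have /fine_cvgP[finn cvn] := trn.
apply/cvgrPdist_le => e e0.
(* The kernel is bounded by 4. *)
have /cvgrPdist_le/(_ (e / 4) (divr_gt0 e0 _)) := cvn.
move=> /(_ (ltr0Sn _ 3)) near4.
near=> n.
have HO : half_ball x nu n.+1%:R^-1 `<=` Omega by near: n.
have n3 : 0 < n.+1%:R ^+ 3 :> R by rewrite exprn_gt0.
have iUij : lebesgue3.-integrable (half_ball x nu n.+1%:R^-1) (EFin \o (fun y => U y i j)).
  exact: integrableS (iU i j).
have fin1 : ((n.+1%:R ^+ 3)%:E * \int[lebesgue3]_(y in half_ball x nu (n.+1%:R^-1 : R))
    (enorm (U y - A))%:E)%E \is a fin_num by near: n.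
have small1 : `|0 - fine ((n.+1%:R ^+ 3)%:E *
    \int[lebesgue3]_(y in half_ball x nu (n.+1%:R^-1 : R)) (enorm (U y - A))%:E)%E| <= e / 4.
  by near: n.
set E := (\int[lebesgue3]_(y in half_ball x nu (n.+1%:R^-1 : R)) (enorm (U y - A))%:E)%E in fin1 small1.
have Efin : E \is a fin_num.
  move: fin1.
  have : (0 <= E)%E by apply: integral_ge0 => y _; rewrite lee_fin sqrtr_ge0.
  by case: E {small1} => [r||]//= _; rewrite gt0_muley ?lte_fin.
have fE : n.+1%:R ^+ 3 * fine E <= e / 4.
  move: small1; by rewrite sub0r normrN fineM//= => h; apply: le_trans h; exact: ler_norm.
have ien : lebesgue3.-integrable (half_ball x nu n.+1%:R^-1) (EFin \o (fun y => enorm (U y - A))).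
  apply/integrableP; split.
    by apply/measurable_EFinP; exact: measurable_enormB.
  under eq_integral do rewrite gee0_abs ?lee_fin ?sqrtr_ge0//.
  by rewrite -ge0_fin_numE//; apply: integral_ge0 => y _; rewrite lee_fin sqrtr_ge0.
have idK : lebesgue3.-integrable (half_ball x nu n.+1%:R^-1)
    (EFin \o (fun y => (U y i j - A i j) * ker k (dil x n y))).
  have := integrableB (mH n) (integrable_Mker x n k (mH n) iUij)
    (integrableZl (mH n) (A i j) (integrable_ker_dil x n k nu)).
  by congr integrable; apply/funext => y /=; rewrite mulrBl EFinB !EFinM.
have iAK : lebesgue3.-integrable (half_ball x nu n.+1%:R^-1)
    (EFin \o (fun y => A i j * ker k (dil x n y))).
  by have := integrableZl (mH n) (A i j) (integrable_ker_dil x n k nu).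
have -> : \int[lebesgue3]_(y in half_ball x nu n.+1%:R^-1) (U y i j * ker k (dil x n y)) =
   \int[lebesgue3]_(y in half_ball x nu n.+1%:R^-1) ((U y i j - A i j) * ker k (dil x n y))
   + A i j * (n.+1%:R ^- 3 * (kappa * nu 0 k)).
  rewrite -(Rintegral_half_ball_ker x n k nu1) -RintegralZl//; last exact: integrable_ker_dil.
  rewrite -RintegralD//; apply: eq_Rintegral => y _; ring.
set I := \int[lebesgue3]_(y in half_ball x nu n.+1%:R^-1) ((U y i j - A i j) * ker k (dil x n y)).
have -> : kappa * (A i j * nu 0 k) -
   n.+1%:R ^+ 3 * (I + A i j * (n.+1%:R ^- 3 * (kappa * nu 0 k))) = - (n.+1%:R ^+ 3 * I).
  by field; rewrite lt0r_neq0.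
rewrite normrN normrM (gtr0_norm n3).
have IE : `|I| <= 4 * fine E.
  apply: le_trans (le_normr_Rintegral (mH n) idK) _.
  rewrite -[4 * _](_ : \int[lebesgue3]_(y in half_ball x nu n.+1%:R^-1)
    (4 * enorm (U y - A)) = _); last exact: RintegralZl.
  apply: le_Rintegral => //.
  - by have := integrable_norm idK.
  - by have := integrableZl (mH n) 4 ien.
  - move=> y _; rewrite normrM mulrC ler_pM//; first exact: ker_bounded.
    by have := coord_le_enorm (U y - A) i j; rewrite !mxE.
rewrite (le_trans (ler_wpM2l (ltW n3) IE))//; lra.
Unshelve. all: by end_near. Qed.

End blowup.

Section blow.
Context {R : realType}.
Local Notation V := 'rV[R]_3.
Implicit Types (nu x y z : V) (n : nat).

Variables (Omega : set V) (U : V -> 'M[R]_3).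
Hypothesis Omega_open : open Omega.
Hypothesis iU : forall i j, lebesgue3.-integrable Omega (EFin \o (fun y => U y i j)).

Let mOmega : measurable Omega. Proof. exact: open_measurable_rV. Qed.

Definition blow i j k n x : R :=
  n.+1%:R ^+ 3 * \int[lebesgue3]_(y in Omega) (U y i j * ker k (dil x n y)).

Lemma measurable_hyperplane nu : measurable [set z : V | dotv z nu = 0].
Proof.
rewrite -[X in measurable X]setTI.
exact: (continuous_measurable_rV (@continuous_dotvl R nu) measurableT (measurable_set1 0)).
Qed.

Lemma affine_hyperplane_dil x nu :
  [set y | dotv (y - x) nu = 0] = dil x 0 @^-1` [set z | dotv z nu = 0].
Proof. by apply/seteqP; split => y /=; rewrite dotv_dill mul1r. Qed.

Lemma lebesgue3_affine_hyperplane x nu : dotv nu nu = 1 ->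
  lebesgue3 [set y | dotv (y - x) nu = 0] = 0%E.
Proof.
move=> nu1; rewrite affine_hyperplane_dil (volume_dil x 0).2; last exact: measurable_hyperplane.
by rewrite lebesgue3_hyperplane// mule0.
Qed.

(** The kernel vanishes off the open ball, and removing the null hyperplane through [x] leaves the
    two half balls. *)
Lemma Rintegral_ker_split x nu n k (F : V -> R) : dotv nu nu = 1 ->
  lebesgue3.-integrable Omega (EFin \o F) -> shrunk_ball x n `<=` Omega ->
  \int[lebesgue3]_(y in Omega) (F y * ker k (dil x n y)) =
  \int[lebesgue3]_(y in half_ball x nu n.+1%:R^-1) (F y * ker k (dil x n y)) +
  \int[lebesgue3]_(y in half_ball x (- nu) n.+1%:R^-1) (F y * ker k (dil x n y)).
Proof.
move=> nu1 iF BO; pose P : set V := [set y | dotv (y - x) nu = 0].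
have iK := integrable_Mker x n k mOmega iF.
have mH := measurable_half_ball x nu n; have mH' := measurable_half_ball x (- nu) n.
have HO := subset_trans (@half_ball_shrunk _ x nu n) BO.
have HO' := subset_trans (@half_ball_shrunk _ x (- nu) n) BO.
have mP : measurable P.
  rewrite /P affine_hyperplane_dil -[X in measurable X]setTI.
  by apply: (volume_dil x 0).1 => //; exact: measurable_hyperplane.
have P0 : lebesgue3 P = 0%E by exact: lebesgue3_affine_hyperplane.
rewrite /Rintegral (negligible_integral mP mOmega iK P0) -!/(Rintegral _ _ _).
have dN z : dotv z (- nu) = - dotv z nu by rewrite !dotvE !mxE; ring.
have en y : n.+1%:R ^+ 2 * dotv (y - x) (y - x) < 1 <-> enorm (y - x) < n.+1%:R^-1.
  by rewrite enorm_lt ?invr_gt0// mulrC -ltr_pdivlMr ?exprn_gt0// div1r -exprVn.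
rewrite -Rintegral_setU//.
- rewrite [LHS]Rintegral_mkcond [RHS]Rintegral_mkcond; apply: eq_Rintegral => y _.
  rewrite /patch; have [/set_mem yH|] := boolP (y \in _ `|` _).
    rewrite ifT// inE; split; first by case: yH => [/HO|/HO'].
    rewrite /P /= => y0; case: yH; rewrite /half_ball/= ?dN y0 ?oppr0 ltxx; by case.
  rewrite notin_setE => yH; case: ifPn => // /set_mem [Oy /eqP Py].
  rewrite ker_out ?mulr0// dotv_dil leNgt; apply/negP => /en ny; apply: yH.
  by move: Py; rewrite neq_lt => /orP[h|h]; [right|left]; split => //; rewrite dN oppr_gt0.
- by apply: integrableS iK => //; [exact: measurableU|move=> y []; [exact: HO|exact: HO']].
- apply/disj_setPS => y [[_ h1] [_]]; rewrite dN oppr_gt0 => h2.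
  by have := lt_trans h1 h2; rewrite ltxx.
Qed.

(** The half ball carrying [Um] has normal [- nu]; this sign turns the sum of the two one-sided
    limits into the jump. *)
Lemma blow_cvg x Up Um nu i j k : jump_triple Omega U x Up Um nu ->
  blow i j k n x @[n --> \oo] --> kappa * ((Up i j - Um i j) * nu 0 k).
Proof.
move=> [Ox nu1 _ tp tm].
have {}nu1 : dotv nu nu = 1.
  by move: nu1; rewrite enorm_rV => h; rewrite -(sqr_sqrtr (dotv_ge0 nu)) h expr1n.
have nuN : dotv (- nu) (- nu) = 1 by rewrite -nu1 !dotvE !mxE; ring.
pose I nu' n := n.+1%:R ^+ 3 *
  \int[lebesgue3]_(y in half_ball x nu' n.+1%:R^-1) (U y i j * ker k (dil x n y)).
have cv : I nu n + I (- nu) n @[n --> \oo] --> kappa * ((Up i j - Um i j) * nu 0 k).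
  have -> : kappa * ((Up i j - Um i j) * nu 0 k) =
    kappa * (Up i j * nu 0 k) + kappa * (Um i j * (- nu) 0 k) by rewrite mxE; ring.
  by apply: cvgD; [exact: (half_blowup Omega_open iU Ox nu1 tp)|
    exact: (half_blowup Omega_open iU Ox nuN tm)].
apply: cvg_trans cv; apply: near_eq_cvg.
have := near_shrunk_ball (open_nbhs_nbhs (conj Omega_open Ox)).
apply: filterS => n BO.
by rewrite /blow /I (Rintegral_ker_split k nu1 (iU i j) BO) mulrDr.
Qed.

Lemma dbump_ker n x k y : dbump n.+1%:R x 0 k y = n.+1%:R * ker k (dil x n y).
Proof. by rewrite /dbump /ker /bump dotv_dil !mxE; ring. Qed.

Lemma is_derive_dbump (N : R) x j k y :
  is_derive y (delta_mx 0 j) (dbump N x 0 k)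
   (- (2 * N ^+ 2) * ((j == k)%:R * bump N x 2 y - 2 * N ^+ 2 *
     ((y 0 j - x 0 j) * (y 0 k - x 0 k) * (bump N x 4 y - 2 * bump N x 3 y)))).
Proof.
rewrite (_ : dbump N x 0 k = fun y => - (2 * N ^+ 2) * ((y 0 k - x 0 k) * bump N x 2 y)); last first.
  by apply/funext => z; rewrite /dbump; ring.
have := is_deriveZ (- (2 * N ^+ 2)) (is_deriveM (is_derive_coordB x k j y) (is_derive_bump N x 2 j y)).
move/is_derive_eq; apply.
by rewrite /dbump /GRing.scale/= eq_sym; ring.
Qed.

Lemma partial_dbumpC (N : R) x j k : partial j (dbump N x 0 k) = partial k (dbump N x 0 j).
Proof.
apply/funext => y; rewrite /partial.
have [_ ->] := is_derive_dbump N x j k y; have [_ ->] := is_derive_dbump N x k j y.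
by rewrite eq_sym; ring.
Qed.

Lemma partial_bump (N : R) x j : partial j (bump N x 0) = dbump N x 0 j.
Proof. by apply/funext => y; rewrite /partial; have [_ ->] := is_derive_bump N x 0 j y. Qed.

(** This exhibits [blow] as a pairing with a derivative of a test function, the form to which the
    weak gradient and the BV measures apply. *)
Lemma blow_dbump i j k n x : blow i j k n x =
  n.+1%:R ^+ 2 * \int[lebesgue3]_(y in Omega) (U y i j * dbump n.+1%:R x 0 k y).
Proof.
rewrite /blow exprSr -mulrA -RintegralZl//; last exact: integrable_Mker.
congr (_ * _); apply: eq_Rintegral => y _; rewrite dbump_ker; ring.
Qed.

(** The first derivatives of the bump are themselves used as test functions, so [phi] is paired with
    mixed second derivatives. Equality holds only once the support of the bump fits inside
    [Omega]. *)
Lemma blow_sym phi x i j k : weak_gradient Omega phi U -> Omega x ->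
  \forall n \near \oo, blow i j k n x = blow i k j n x.
Proof.
move=> wg Ox; have := near_shrunk_ball (open_nbhs_nbhs (conj Omega_open Ox)).
apply: filterS => n BO; rewrite !blow_dbump; congr (_ * _).
have tst l : test_function Omega (dbump n.+1%:R x 0 l).
  by apply: (@test_bumpy R n.+1%:R x) => //; exact: bumpy_dbump.
have [_ _ /(_ _ (tst k)) h1] := wg i j; have [_ _ /(_ _ (tst j)) h2] := wg i k.
by apply: oppr_inj; rewrite -h1 -h2 partial_dbumpC.
Qed.

(** The bump lies below the indicator of the ball: it is at most [0! = 1], and its Euclidean support
    is contained, up to points where it vanishes, in the sup-norm ball of the same radius. *)
Lemma Rintegral_bump_le (mu : {finite_measure set V -> \bar R}) n x :
  0 <= \int[mu]_(y in Omega) bump n.+1%:R x 0 y <= fine (mu (ball x n.+1%:R^-1)).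
Proof.
have b0 y : 0 <= bump n.+1%:R x 0 y by exact: flat_ge0.
apply/andP; split; first by apply: Rintegral_ge0 => y _.
have mB := measurable_ball_rV x n.+1%:R^-1.
have mb : measurable_fun Omega (bump n.+1%:R x 0).
  by apply: measurable_funTS; apply: continuous_measurable_rV; exact: continuous_bump.
have bB y : bump n.+1%:R x 0 y <= \1_(ball x n.+1%:R^-1 : set V) y.
  have [y1|y1] := ltP (n.+1%:R ^+ 2 * dotv (y - x) (y - x)) 1; last first.
    by rewrite (bumpy_out (bumpy_bump _ _ 0))//; rewrite indicE.
  rewrite indicE mem_set; first by rewrite (le_trans (flat_bounded _ _)).
  rewrite ball_rVE ?invr_gt0// => i /=.
  have := @coord_lt1 R (dil x n y) i; rewrite dotv_dil => /(_ y1).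
  by rewrite !mxE normrM gtr0_norm// mulrC -ltr_pdivlMr// div1r.
have ii : mu.-integrable Omega (EFin \o \1_(ball x n.+1%:R^-1 : set V)).
  by apply: (@integrableS _ _ _ _ setT) => //; exact: integrable_indic.
apply: (@le_trans _ _ (\int[mu]_(y in Omega) \1_(ball x n.+1%:R^-1 : set V) y)).
  apply: le_Rintegral => //.
  apply: le_integrable ii => //; first exact/measurable_EFinP.
  by move=> y _; rewrite /= lee_fin !ger0_norm// indicE.
rewrite /Rintegral integral_indic//; apply: fine_le.
- by apply: fin_num_measure; exact: measurableI.
- exact: fin_num_measure.
- by apply: le_measure; rewrite ?inE//; exact: measurableI.
Qed.

(** [mu] adds up the positive and negative measures of the three entries of row [i], so one measure
    dominates the whole contracted sum. *)
Lemma blow_bound : BV_mx Omega U -> forall i, exists2 mu : {measure set V -> \bar R},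
  (mu setT < +oo)%E &
  forall x, Omega x -> \forall n \near \oo,
    `| \sum_j blow i j j n x | <= n.+1%:R ^+ 2 * fine (mu (ball x n.+1%:R^-1)).
Proof.
move=> bv i.
have /choice[mp] : forall j, exists mup : {finite_measure set V -> \bar R},
  exists mun : {finite_measure set V -> \bar R},
    forall psi, test_function Omega psi ->
      \int[lebesgue3]_(x in Omega) (U x i j * partial j psi x) =
      - (\int[mup]_(x in Omega) psi x - \int[mun]_(x in Omega) psi x).
  by move=> j; have [_ /(_ j)] := bv i j.
move=> /choice[mn h].
pose mu : {measure set V -> \bar R} := measure_add
  (measure_add (measure_add (mp ord0) (mn ord0)) (measure_add (mp (inord 1)) (mn (inord 1))))
  (measure_add (mp ord_max) (mn ord_max)).
have muE A : mu A = ((mp ord0 A + mn ord0 A) + (mp (inord 1) A + mn (inord 1) A) +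
   (mp ord_max A + mn ord_max A))%E.
  apply: etrans (measure_addE _ _ _) _; congr (_ + _)%E; last exact: measure_addE.
  by apply: etrans (measure_addE _ _ _) _; congr (_ + _)%E; exact: measure_addE.
exists mu.
  by rewrite muE -ge0_fin_numE ?adde_ge0// !fin_numD !fin_num_measure.
move=> x Ox; have := near_shrunk_ball (open_nbhs_nbhs (conj Omega_open Ox)).
apply: filterS => n BO.
have tst : test_function Omega (bump n.+1%:R x 0).
  by apply: (@test_bumpy R n.+1%:R x) => //; exact: bumpy_bump.
have bE j : `|blow i j j n x| <= n.+1%:R ^+ 2 *
  (fine (mp j (ball x n.+1%:R^-1)) + fine (mn j (ball x n.+1%:R^-1))).
  rewrite blow_dbump -partial_bump h// normrM ger0_norm ?exprn_ge0// ler_wpM2l ?exprn_ge0//.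
  have /andP[p0 p1] := Rintegral_bump_le (mp j) n x.
  have /andP[n0 n1] := Rintegral_bump_le (mn j) n x.
  by rewrite normrN ler_norml; apply/andP; split; lra.
have mB := measurable_ball_rV x n.+1%:R^-1.
rewrite muE !fineD ?fin_numD ?fin_num_measure// sum_ord3 !mulrDr.
have := bE ord0; have := bE (inord 1); have := bE ord_max; rewrite !mulrDr => h2 h1 h0.
by rewrite (le_trans (ler_normD _ _))// lerD// (le_trans (ler_normD _ _))// lerD.
Qed.

End blow.

Section blow_measurable.
Context {R : realType}.
Local Notation V := 'rV[R]_3.

Lemma measurable_param_integral (f : V * V -> \bar R) :
  measurable_fun setT f -> (forall p, 0 <= f p)%E ->
  measurable_fun setT (fun x : V => \int[lebesgue3]_y f (x, y))%E.
Proof.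
move=> mf f0.
have sf : sigma_finite setT (@lebesgue3 R).
  exists (fun k => cube k%:R); first by rewrite bigcup_cube.
  by move=> k; split; [exact: measurable_box_rV|exact: lebesgue3_cube_lty].
(* [lebesgue3] is declared as a plain measure; Tonelli's theorem asks for the sigma-finite
   structure, which is packed here. *)
pose m := Measure_isSigmaFinite.Build _ _ _ (@lebesgue3 R) sf.
pose mu : {sigma_finite_measure set V -> \bar R} := HB.pack (@lebesgue3 R) m.
exact: (measurable_fun_fubini_tonelli_F (m2 := mu) f mf f0).
Qed.

Variables (Omega : set V) (U : V -> 'M[R]_3).
Hypothesis Omega_open : open Omega.
Hypothesis iU : forall i j, lebesgue3.-integrable Omega (EFin \o (fun y => U y i j)).

(** Extending [U] by 0 makes the integrand Borel on the product; Tonelli is then applied to its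
    positive and negative parts separately. *)
Lemma measurable_blow i j k n : measurable_fun setT (blow Omega U i j k n).
Proof.
have mOmega : measurable Omega by exact: open_measurable_rV.
pose u : V -> R := (fun y => U y i j) \_ Omega.
have mu : measurable_fun setT u.
  have /measurable_EFinP m := measurable_int _ (iU i j).
  exact: (measurable_restrictT _ mOmega).1 m.
pose F (p : V * V) : \bar R := (u p.2 * ker k (dil p.1 n p.2))%:E.
have mF : measurable_fun setT F.
  apply/measurable_EFinP; apply: measurable_funM.
    by apply: measurableT_comp => //; exact: measurable_snd.
  apply: (measurableT_comp (f := ker k)).
    by apply: continuous_measurable_rV; exact: continuous_ker.
  apply: measurable_fun_rV => l; under eq_fun do rewrite !mxE.
  apply: measurable_funM => //; apply: measurable_funB.
    by apply: (measurableT_comp (measurable_coord_rV l)); exact: measurable_snd.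
  by apply: (measurableT_comp (measurable_coord_rV l)); exact: measurable_fst.
rewrite (_ : blow _ _ _ _ _ _ = fun x => n.+1%:R ^+ 3 *
    fine (\int[lebesgue3]_y F^\+%E (x, y) - \int[lebesgue3]_y F^\-%E (x, y))%E).
  apply: measurable_funM => //; apply: (measurableT_comp (f := fine)).
    exact: fine_measurable.
  apply: emeasurable_funB; apply: measurable_param_integral.
  - exact: measurable_funepos.
  - by move=> p; exact: funepos_ge0.
  - exact: measurable_funeneg.
  - by move=> p; exact: funeneg_ge0.
apply/funext => x; rewrite /blow Rintegral_mkcond /Rintegral integralE.
have -> : (fun y => (((fun y => U y i j * ker k (dil x n y)) \_ Omega) y)%:E) = F \o pair x.
  apply/funext => y; rewrite /F /u /patch /=.
  by case: ifP => // _; rewrite mul0r.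
by rewrite funepos_comp funeneg_comp.
Qed.
End blow_measurable.

(** * Hausdorff measure of Borel sets *)

Section hausdorff.
Context {R : realType}.
Local Notation V := 'rV[R]_3.
Local Notation H2 := (@hausdorff2 R).
Implicit Types (A B : set V).
Local Open Scope ereal_scope.

Lemma hausdorff2_pre_le (d1 d2 : R) A : (d1 <= d2)%R ->
  hausdorff2_pre d2 A <= hausdorff2_pre d1 A.
Proof.
move=> d12; apply: le_ereal_inf => _ [F [AF Fd] <-]; exists F => //; split => // k.
by rewrite (le_trans (Fd k))// lee_fin.
Qed.

Lemma hausdorff2_pre_sup (d : R) A : (0 < d)%R -> hausdorff2_pre d A <= H2 A.
Proof. by move=> d0; apply: ereal_sup_ubound; exists d. Qed.

Lemma hausdorff_term_ge0 (E : set V) : 0 <= (pi / 4)%:E * ediam E ^+ 2.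
Proof. by rewrite mule_ge0 ?lee_fin ?divr_ge0 ?pi_ge0// expe_ge0// ediam_ge0. Qed.

Lemma hausdorff_term_set0 : (pi / 4)%:E * ediam (set0 : set V) ^+ 2 = 0.
Proof. by rewrite ediam0 expe2 !mule0. Qed.

(** A covering set of diameter at most [d] cannot meet both [A] and [B], so a cover of the union
    splits into two covers. Sets not meeting the given part are replaced by the empty set, which
    costs nothing. *)
Lemma hausdorff2_pre_sep (d : R) A B :
  (forall x y, A x -> B y -> (d < enorm (x - y)%R)%R) ->
  hausdorff2_pre d A + hausdorff2_pre d B <= hausdorff2_pre d (A `|` B).
Proof.
move=> dAB; apply: le_ereal_inf_tmp => _ [F [ABF Fd] <-].
pose G (C : set V) k := if pselect (F k `&` C !=set0) then F k else set0.
have GC C k : ediam (G C k) <= d%:E.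
  rewrite /G; case: pselect => [FC|nFC] /=; first exact: Fd.
  rewrite ediam0.
  by apply: le_trans (Fd 0%N); exact: ediam_ge0.
have cG C : C `<=` A `|` B -> C `<=` \bigcup_k G C k.
  move=> CAB x Cx; have [k _ Fx] := ABF _ (CAB _ Cx); exists k => //.
  by rewrite /G; case: pselect => [//|nFC] /=; case: nFC; exists x.
have leG C : C `<=` A `|` B ->
    hausdorff2_pre d C <= \sum_(k <oo) (pi / 4)%:E * ediam (G C k) ^+ 2.
  by move=> CAB; apply: ereal_inf_lbound; exists (G C) => //; split=> //; exact: cG.
apply: (le_trans (leeD (leG A (@subsetUl _ A B)) (leG B (@subsetUr _ A B)))).
have tG C k : 0 <= (pi / 4)%:E * ediam (G C k) ^+ 2 by exact: hausdorff_term_ge0.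
rewrite -nneseriesD//.
apply: lee_nneseries => [k _ _|k _]; first by rewrite adde_ge0// hausdorff_term_ge0.
rewrite /G; case: pselect => [[x [Fx Ax]]|nA]; case: pselect => [[y [Fy By]]|nB].
- have : (enorm (x - y)%R)%:E <= ediam (F k).
    by apply: ereal_sup_ubound; right; exists x => //; exists y.
  by move=> /le_trans /(_ (Fd k)); rewrite lee_fin leNgt dAB.
- by rewrite /= hausdorff_term_set0 adde0.
- by rewrite /= hausdorff_term_set0 add0e.
- by rewrite /= hausdorff_term_set0 adde0 hausdorff_term_ge0.
Qed.

(** This is the property of a metric outer measure, from which Carathéodory's criterion starts. *)
Lemma hausdorff2_sep (d : R) A B : (0 < d)%R ->
  (forall x y, A x -> B y -> (d <= enorm (x - y)%R)%R) ->
  H2 A + H2 B <= H2 (A `|` B).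
Proof.
move=> d0 dAB.
have [->|ABoo] := eqVneq (H2 (A `|` B)) +oo; first by rewrite leey.
have fAB : H2 (A `|` B) \is a fin_num by rewrite ge0_fin_numE ?lt_neqAle ?ABoo ?leey ?outer_measure_ge0.
have fC C : C `<=` A `|` B -> H2 C \is a fin_num.
  move=> CAB; rewrite ge0_fin_numE ?outer_measure_ge0//.
  by rewrite (le_lt_trans (le_outer_measure _ _ _ CAB))// -ge0_fin_numE ?outer_measure_ge0.
have key (d1 d2 : R) : (0 < d1)%R -> (0 < d2)%R ->
    hausdorff2_pre d1 A + hausdorff2_pre d2 B <= H2 (A `|` B).
  (* The two suprema run over independent scales, so a common finer scale is taken; [d / 2] makes it
     strictly smaller than the separation. *)
  move=> d10 d20; pose e : R := (Num.min (Num.min d1 d2) (d / 2))%R.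
  have e0 : (0 < e)%R by rewrite !lt_min d10 d20 divr_gt0.
  have ed : (e < d)%R by rewrite gt_min ltr_pdivrMr// ltr_pMr// ltr1n orbT.
  apply: le_trans (hausdorff2_pre_sup _ e0).
  apply: le_trans (hausdorff2_pre_sep _); last first.
    by move=> x y Ax By; apply: lt_le_trans ed (dAB _ _ Ax By).
  by apply: leeD; apply: hausdorff2_pre_le; rewrite /e !ge_min lexx ?orbT.
have fA : H2 A \is a fin_num by apply: fC; exact: subsetUl.
have fB : H2 B \is a fin_num by apply: fC; exact: subsetUr.
rewrite -leeBrDr//.
apply: ge_ereal_sup => _ [d1 d10 <-].
have f1 : hausdorff2_pre d1 A \is a fin_num.
  rewrite ge0_fin_numE.
    by rewrite (le_lt_trans (hausdorff2_pre_sup _ d10))// -ge0_fin_numE ?outer_measure_ge0.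
  by apply: le_ereal_inf_tmp => _ [F _ <-]; apply: nneseries_ge0 => k _ _; exact: hausdorff_term_ge0.
rewrite leeBrDr//.
rewrite addeC -leeBrDr//.
apply: ge_ereal_sup => _ [d2 d20 <-].
by rewrite leeBrDr// addeC key.
Qed.

Lemma hausdorff2_chain (S : nat -> set V) (X : set V) : (forall n, S n `<=` X) ->
  (forall n, exists2 d : R, (0 < d)%R & forall k x y, (k < n)%N -> S n x -> S k y ->
     (d <= enorm (x - y)%R)%R) ->
  \sum_(k <oo) H2 (S k) <= H2 X.
Proof.
move=> SX Ssep; apply: lime_le; first by apply: is_cvg_nneseries => k _ _; exact: outer_measure_ge0.
apply: nearW => n; apply: le_trans (le_outer_measure H2 (\bigcup_(k < n) S k) _ _); last first.
  by move=> x [k _]; exact: SX.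
elim: n => [|n IH]; first by rewrite big_nil outer_measure_ge0.
rewrite big_nat_recr//= bigcup_mkord big_ord_recr/= -bigcup_mkord.
have [d d0 dS] := Ssep n.
rewrite addeC setUC; apply: le_trans (hausdorff2_sep d0 _).
  by rewrite leeD2l.
by move=> x y Sx [k /= kn Sy]; exact: dS kn Sx Sy.
Qed.

Lemma coord_le_enormB (x y : V) i : (`|x 0 i - y 0 i| <= enorm (x - y))%R.
Proof.
have := coord_le_dotv (x - y) i; rewrite !mxE enorm_rV => h.
by rewrite -sqrtr_sqr ler_sqrt// dotv_ge0.
Qed.

(* The shells [S k] accumulating at the boundary have a finite total measure,
   since every other one is separated from the previous ones. *)
Lemma caratheodory_ray i (a : R) :
  (H2 : {outer_measure set V -> \bar R}).-caratheodory [set x : V | (a < x 0 i)%R].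
Proof.
pose A : set V := [set x : V | (a < x 0 i)%R].
apply: le_caratheodory_measurable => X; rewrite -/A.
have [Xoo|Xoo] := eqVneq (H2 X) +oo.
  by apply: (@le_trans _ _ +oo); [exact: leey|rewrite -Xoo].
have fX : H2 X < +oo by rewrite lt_neqAle Xoo leey.
pose t (n : nat) : R := (n.+1%:R^-1)%R.
have t0 n : (0 < t n)%R by rewrite invr_gt0.
have tlt m n : (m < n)%N -> (t n < t m)%R.
  by move=> mn; rewrite ltf_pV2 ?posrE// ltr_nat.
pose A_ m := X `&` [set x | (a + t m <= x 0 i)%R].
pose S k := X `&` [set x | (a + t k.+1 <= x 0 i < a + t k)%R].
have S0 k : 0 <= H2 (S k) by exact: outer_measure_ge0.
(* [f] will enumerate the even and then the odd indices; the condition leaves a whole shell between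
   any two selected ones. The total over all shells is then at most [2 H^2 X]. *)
have sumS (f : nat -> nat) : (forall k n, (k < n)%N -> (f k).+1 < f n)%N ->
    \sum_(k <oo) H2 (S (f k)) <= H2 X.
  move=> fmono; apply: hausdorff2_chain => [n x []//|[|n]]; first by exists 1%R.
  exists (t (f n).+1 - t (f n.+1))%R; first by rewrite subr_gt0 tlt// fmono.
  move=> k x y kn [_ /= /andP[_ x2]] [_ /= /andP[y1 _]].
  apply: le_trans (coord_le_enormB x y i); rewrite distrC.
  apply: le_trans (ler_norm _).
  have : (t (f n).+1 <= t (f k).+1)%R.
    move: kn; rewrite ltnS leq_eqVlt => /predU1P[->//|kn].
    by rewrite ltW// tlt// ltnS (ltn_trans (ltnSn _))// fmono.
  by lra.
have tail : \sum_(k <oo) H2 (S k) < +oo.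
  have half f : (forall k n, (k < n)%N -> (f k).+1 < f n)%N -> forall n,
      \sum_(0 <= k < n) H2 (S (f k)) <= H2 X.
    move=> fm n; apply: le_trans (sumS f fm).
    by apply: nneseries_lim_ge => k _ _; exact: S0.
  apply: (@le_lt_trans _ _ (H2 X + H2 X)); last exact: lte_add_pinfty.
  apply: lime_le; first by apply: is_cvg_nneseries => k _ _; exact: S0.
  apply: nearW => n; apply: (@le_trans _ _ (\sum_(0 <= k < n.*2) H2 (S k))).
    apply: (@lee_sum_nneg_natr _ (fun k => H2 (S k)) xpredT 0) => //.
    by rewrite -addnn leq_addr.
  have -> : \sum_(0 <= k < n.*2) H2 (S k) =
      \sum_(0 <= k < n) H2 (S k.*2) + \sum_(0 <= k < n) H2 (S k.*2.+1).
    elim: (n) => [|p IH]; first by rewrite !big_nil adde0.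
    by rewrite doubleS !big_nat_recr//= IH addeACA addeA.
  by apply: leeD; apply: half => k p kp; rewrite ?ltnS -doubleS leq_double.
have A_C m : H2 (A_ m) + H2 (X `&` ~` A) <= H2 X.
  apply: le_trans (le_outer_measure H2 (A_ m `|` (X `&` ~` A)) _ _); last by move=> x [[]|[]].
  apply: (hausdorff2_sep (t0 m)) => x y [_ /= xm] [_ /negP]; rewrite /A/= -leNgt => ya.
  apply: le_trans (coord_le_enormB x y i).
  by apply: le_trans (ler_norm _); lra.
have XA m : X `&` A `<=` A_ m `|` \bigcup_(k in ~` `I_m) S k.
  move=> x [Xx ax]; have [h|xm] := leP (a + t m)%R (x 0 i)%R; first by left.
  have ex : exists n, (a + t n <= x 0 i)%R.
    have xa : (0 < x 0 i - a)%R by rewrite subr_gt0.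
    have [n _ /(_ n (leqnn n)) /= nx] := near_infty_natSinv_lt (PosNum xa).
    by exists n; rewrite /t; move: nx; move: (n.+1%:R^-1)%R => z ?; lra.
  (* The least [n] with [a + t n <= x_i] tells which shell contains [x]. *)
  case: (ex_minnP ex) => -[|n] nx nmin.
    move: (xm); rewrite ltNge (le_trans _ nx)// lerD2l.
    by have [->//|m0] := posnP m; rewrite ltW// tlt.
  have mn : (m <= n)%N.
    rewrite leqNgt; apply/negP => nm; move: xm; rewrite ltNge (le_trans _ nx)// lerD2l.
    by move: nm; rewrite leq_eqVlt => /predU1P[->//|nm]; rewrite ltW// tlt.
  right; exists n; first by apply/negP; rewrite -leqNgt.
  split => //=; rewrite nx ltNge; apply/negP => /nmin.
  by rewrite ltnn.
apply/lee_addgt0Pr => e e0.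
have /fine_cvgP[finT cvT] : (\sum_(m <= k <oo) H2 (S k)) @[m --> \oo] --> (0%R)%:E.
  exact: nneseries_tail_cvg.
have [m _ /(_ m (leqnn m)) [Tf Te]] : \forall m \near \oo, (\sum_(m <= k <oo) H2 (S k)) \is a fin_num /\
   (`|0 - fine (\sum_(m <= k <oo) H2 (S k))| <= e)%R.
  near=> m; split; near: m => //.
  by move/cvgrPdist_le : cvT; apply.
apply: (@le_trans _ _ (H2 (A_ m) + e%:E + H2 (X `&` ~` A))).
  rewrite leeD2r//; apply: le_trans (le_outer_measure H2 _ _ (XA m)) _.
  apply: le_trans (outer_measureU2 _ _ _) _; rewrite leeD2l//.
  apply: le_trans (outer_measure_sigma_subadditive_tail _ _ _) _.
  by rewrite -(fineK Tf) lee_fin; apply: le_trans Te; rewrite sub0r normrN ler_norm.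
by rewrite addeAC leeD2r.
Unshelve. all: by end_near. Qed.
End hausdorff.

Section borel.
Context {R : realType}.
Local Notation V := 'rV[R]_3.
Local Notation H2 := (@hausdorff2 R).

Lemma borel_caratheodory (A : set V) : measurable A ->
  (H2 : {outer_measure set V -> \bar R}).-caratheodory A.
Proof.
move: A; apply: sigma_algebra_rays; last exact: caratheodory_ray.
split.
- exact: caratheodory_measurable_set0.
- by move=> A mA; rewrite setTD; exact: caratheodory_measurable_setC.
- exact: caratheodory_measurable_bigcup.
Qed.

Lemma measurable_hausdorff (A : set V) : measurable A ->
  @measurable _ (@hausdorff_type R) A.
Proof. exact: borel_caratheodory. Qed.

(** * Regularity of finite Borel measures *)

Variable mu : {measure set V -> \bar R}.
Hypothesis mu_fin : (mu setT < +oo)%E.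

Let mu_lty A : measurable A -> (mu A < +oo)%E.
Proof.
by move=> mA; apply: le_lt_trans mu_fin; apply: le_measure; rewrite ?inE.
Qed.

(** Inner closed and outer open approximations are demanded together: complementation exchanges
    them, so the class is stable under complements. *)
Definition regular (A : set V) := measurable A /\ forall e : R, 0 < e ->
  exists F W, [/\ closed F, open W, F `<=` A, A `<=` W & (mu (W `\` F) <= e%:E)%E].

Lemma closed_measurable_rV (F : set V) : closed F -> measurable F.
Proof.
by move=> cF; rewrite -[F]setCK; apply: measurableC; apply: open_measurable_rV; rewrite openC.
Qed.

(** A countable union of closed sets need not be closed. As [mu] is finite, continuity from above
    lets a finite stage replace the union at the extra cost [e]. *)
Lemma regular_approx (A W : set V) (F : nat -> set V) : measurable A -> open W ->
  A `<=` W -> (forall n, closed (F n)) -> (forall n, F n `<=` F n.+1) ->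
  (forall n, F n `<=` A) -> forall c e : R, 0 < e ->
  (mu (W `\` \bigcup_n F n) <= c%:E)%E ->
  exists F W, [/\ closed F, open W, F `<=` A, A `<=` W & (mu (W `\` F) <= (c + e)%:E)%E].
Proof.
move=> mA oW AW cF ndF FA c e e0 muc.
have mF n := closed_measurable_rV (cF n).
have mW := open_measurable_rV oW.
have cvF : mu (W `\` F n) @[n --> \oo] --> mu (\bigcap_n (W `\` F n)).
  apply: nonincreasing_cvg_mu.
  - by apply: mu_lty; exact: measurableD.
  - by move=> n; exact: measurableD.
  - by apply: bigcapT_measurable => n; exact: measurableD.
  - apply/nonincreasing_seqP => n; apply/subsetPset; apply: setDS; exact: ndF.
have cap : \bigcap_n (W `\` F n) = W `\` \bigcup_n F n.
  apply/seteqP; split => x; last by move=> [Wx nF] n _; split => // Fx; apply: nF; exists n.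
  by move=> h; split; [have [] := h 0%N I|move=> [n _ Fx]; have [_] := h n I; apply].
rewrite cap in cvF.
have fm : mu (W `\` \bigcup_n F n) \is a fin_num.
  by rewrite ge0_fin_numE// mu_lty//; apply: measurableD => //; exact: bigcupT_measurable.
rewrite -(fineK fm) in cvF.
have /fine_cvgP[ff /cvgrPdist_le/(_ _ e0) fd] := cvF.
have [n _ /(_ n (leqnn n)) [fn dn]] : \forall n \near \oo, mu (W `\` F n) \is a fin_num /\
   `|fine (mu (W `\` \bigcup_n F n)) - fine (mu (W `\` F n))| <= e.
  by near=> n; split; near: n.
exists (F n), W; split => //.
rewrite -(fineK fn) lee_fin.
move: muc; rewrite -(fineK fm) lee_fin => muc.
move: dn; rewrite distrC => /(le_trans (ler_norm _)); lra.
Unshelve. all: by end_near. Qed.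

Lemma regular_measurable (A : set V) : measurable A -> regular A.
Proof.
move: A; apply: sigma_algebra_rays.
  split.
  - split=> // e e0; exists set0, set0; rewrite setD0 measure0 lee_fin ltW//.
    by split=> //; exact: closed0.
  - move=> A [mA rA]; rewrite setTD; split; first exact: measurableC.
    move=> e e0; have [F [W [cF oW FA AW mFW]]] := rA e e0.
    exists (~` W), (~` F); split; rewrite ?closedC ?openC//; try exact: subsetC.
    by rewrite setDE setCK setIC -setDE.
  - move=> A rA.
    have mA : measurable (\bigcup_k A k) by apply: bigcupT_measurable => k; exact: (rA k).1.
    split => // e e0.
    have e2 : 0 < e / 2 by rewrite divr_gt0.
    (* The geometric errors sum to [e / 2]; the other half pays for cutting the union of the closed
       sets at a finite stage. *)
    have /choice[F /choice[W FW]] : forall k, exists F W, [/\ closed F, open W, F `<=` A k,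
        A k `<=` W & (mu (W `\` F) <= (e / 2 / (2 ^ k.+1)%:R)%:E)%E].
      by move=> k; apply: (rA k).2; rewrite divr_gt0// ltr0n expn_gt0.
    pose F' n := \big[setU/set0]_(k < n.+1) F k.
    have F'E : \bigcup_n F' n = \bigcup_k F k.
      by rewrite /F' bigcup_bigsetU_bigcup.
    rewrite (splitr e).
    apply: (@regular_approx _ (\bigcup_k W k) F') => //.
    + by apply: bigcup_open => k _; have [] := FW k.
    + by move=> x [k _ Ax]; exists k => //; have [_ _ _ + _] := FW k; apply.
    + by move=> n; apply: closed_bigsetU => k _; have [] := FW k.
    + by move=> n; rewrite {2}/F' big_ord_recr/=; exact: subsetUl.
    + move=> n x; rewrite /F' -bigcup_mkord => -[k _ Fx]; exists k => //.
      by have [_ _ + _ _] := FW k; apply.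
    + rewrite F'E.
      have mWF k : measurable (W k `\` F k).
        by have [cF oW _ _ _] := FW k; apply: measurableD;
            [exact: open_measurable_rV|exact: closed_measurable_rV].
      apply: (@le_trans _ _ (\sum_(k <oo) mu (W k `\` F k)))%E.
        apply: measure_sigma_subadditive => //.
          apply: measurableD; apply: bigcupT_measurable => k; have [cF oW _ _ _] := FW k.
            exact: open_measurable_rV.
          exact: closed_measurable_rV.
        move=> x [[k _ Wx] nF]; exists k => //; split => // Fx; apply: nF; exists k => //.
      apply: (@le_trans _ _ (\sum_(k <oo) (e / 2 / (2 ^ k.+1)%:R)%:E))%E.
        by apply: lee_nneseries => // k _; have [] := FW k.
      by apply: epsilon_trick0; exact: ltW.
move=> i a; pose W : set V := [set x : V | a < x 0 i].
have oW : open W.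
  apply: (@open_comp _ _ (fun x : V => x 0 i) [set t | a < t]); last exact: open_gt.
  by move=> x _; exact: continuous_coord.
split; first exact: open_measurable_rV.
(* The open half-space is its own outer approximation and is exhausted by closed half-spaces, so the
   initial error is 0. *)
move=> e e0; rewrite -(add0r e).
pose F n : set V := [set x : V | a + n.+1%:R^-1 <= x 0 i].
apply: (@regular_approx _ W F) => //.
- exact: open_measurable_rV.
- move=> n; apply: (@closed_comp _ _ (fun x : V => x 0 i) [set t | a + n.+1%:R^-1 <= t]); last exact: closed_ge.
  by move=> x _; exact: continuous_coord.
- move=> n x /=; apply: le_trans; rewrite lerD2l lef_pV2 ?posrE// ler_nat//.
- move=> n x /=; apply: lt_le_trans; rewrite ltrDl invr_gt0//.
- rewrite (_ : _ `\` _ = set0) ?measure0// -subset0 => x [ax]; apply.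
  have xa : (0 < x 0 i - a) by rewrite subr_gt0.
  have [n _ /(_ n (leqnn n)) /= nx] := near_infty_natSinv_lt (PosNum xa).
  by exists n => //=; move: nx; rewrite /F /=; move: (n.+1%:R^-1) => z ?; lra.
Qed.

Lemma outer_regular (A : set V) (e : R) : measurable A -> 0 < e ->
  exists W, [/\ open W, A `<=` W & (mu W <= mu A + e%:E)%E].
Proof.
move=> mA e0; have [F [W [cF oW FA AW mFW]]] := (regular_measurable mA).2 e e0.
exists W; split => //.
have mW := open_measurable_rV oW; have mF := closed_measurable_rV cF.
rewrite -(setDUK (subset_trans FA AW)).
apply: le_trans (measureU2 _ _ _) _ => //; first exact: measurableD.
by apply: leeD => //; apply: le_measure; rewrite ?inE.
Qed.
End borel.

(** * Covering and density *)

Section vitali.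

(* A maximal disjoint family among those in which every ball met is met by a
   member of smaller level, that is, of larger radius. *)
Lemma vitali_levels (T U : Type) (B : T -> set U) (lvl : T -> nat) (E : set T) :
  (forall x, B x !=set0) ->
  exists D, [/\ D `<=` E, trivIset D B &
    forall x, E x -> exists y, [/\ D y, B x `&` B y !=set0 & (lvl y <= lvl x)%N]].
Proof.
move=> B0.
pose meets (D : set T) x := exists2 y, D y & B x `&` B y !=set0.
pose good (D : set T) x := exists y, [/\ D y, B x `&` B y !=set0 & (lvl y <= lvl x)%N].
pose P (D : set T) := [/\ D `<=` E, trivIset D B & forall x, E x -> meets D x -> good D x].
have [D [[DE tD gD] maxD]] : exists D, P D /\ forall C, D `<` C -> ~ P C.
  apply: Zorn_bigcup => F FP totF; split.
  - by move=> x [D FD Dx]; have [DE _ _] := FP _ FD; exact: DE.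
  - move=> x y [D FD Dx] [D' FD' D'y].
    have [DD'|D'D] := totF _ _ FD FD'.
      by have [_ tD _] := FP _ FD'; apply: tD => //; exact: DD'.
    by have [_ tD _] := FP _ FD; apply: tD => //; exact: D'D.
  - move=> x Ex [y [D FD Dy] xy]; have [_ _ /(_ x Ex)] := FP _ FD.
    by case=> [|z [Dz xz zx]]; [exists y|exists z; split => //; exists D].
exists D; split => // x Ex; apply: (gD x Ex); apply: contrapT => nx.
(* If some member met nothing in [D], one of least level could be adjoined: whatever meets it
   without meeting [D] has at least its level. Natural-number levels ensure that the minimum is
   attained. *)
have ex : exists n, `[< exists z, [/\ E z, ~ meets D z & lvl z = n] >].
  by exists (lvl x); apply/asboolP; exists x.
case: (ex_minnP ex) => n /asboolP[z [Ez nz zn]] nmin.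
have selfz : B z `&` B z !=set0 by rewrite setIid.
apply: (maxD (D `|` [set z])).
  split; first by left.
  by move=> /(_ z (or_intror erefl)) Dz; apply: nz; exists z.
split.
- by move=> w [/DE//|->].
- move=> u v [Du|->] [Dv|->] // uv.
  + exact: tD.
  + by case: nz; exists u => //; rewrite setIC.
  + by case: nz; exists v.
- move=> w Ew mw.
  have [/(gD w Ew)[y [Dy wy yw]]|nw] := pselect (meets D w).
    by exists y; split => //; left.
  have wz : B w `&` B z !=set0.
    by case: mw => y [Dy|->//] wy; case: nw; exists y.
  exists z; split => //; first by right.
  by rewrite zn nmin//; apply/asboolP; exists w.
Qed.
End vitali.

Section density.
Context {R : realType}.
Local Notation V := 'rV[R]_3.
Local Notation H2 := (@hausdorff2 R).
Variable mu : {measure set V -> \bar R}.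
Hypothesis mu_fin : (mu setT < +oo)%E.

(** The sup-norm ball is a cube of side [2 r]; the length [2 sqrt 3 r] of its diagonal is rounded
    up. *)
Lemma ediam_ball (x : V) (r : R) : 0 < r -> (ediam (ball x r) <= (4 * r)%:E)%E.
Proof.
move=> r0; apply: ge_ereal_sup => e [->|[u xu [v xv <-]]].
  by rewrite lee_fin mulr_ge0// ltW.
rewrite lee_fin enorm_rV; move: xu xv; rewrite !ball_rVE// => xu xv.
have uv i : (u 0 i - v 0 i) ^+ 2 <= 4 * r ^+ 2.
  have := xu i; have := xv i; rewrite !ltr_norml => /andP[? ?] /andP[? ?].
  nra.
have r4 : 0 <= 4 * r by rewrite mulr_ge0// ltW.
rewrite -(ger0_norm r4) -sqrtr_sqr ler_sqrt ?sqr_ge0//.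
rewrite dotvE !mxE; have := uv ord0; have := uv (inord 1); have := uv ord_max.
by rewrite !expr2 => *; nra.
Qed.

(** A selected ball of radius [r] has [t r ^ 2 <= mu B], so its double costs at most
    [64 r ^ 2 <= (64 / t) mu B]; the selected balls are disjoint and lie in [W]. The density bound
    recurs at arbitrarily small radii, so every scale [d] can be served. *)
Lemma hausdorff2_density (E W : set V) (t : R) : open W -> E `<=` W -> 0 < t ->
  (forall x, E x -> forall m, exists2 n, (m <= n)%N &
     t <= n.+1%:R ^+ 2 * fine (mu (ball x n.+1%:R^-1))) ->
  (H2 E <= (64 / t)%:E * mu W)%E.
Proof.
move=> oW EW t0 dE; apply: ge_ereal_sup => _ [d /= d0 <-].
have mW := open_measurable_rV oW.
(* The doubled balls have diameter at most 8 times the radius, and this must stay below [d]. *)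
have /choice[n nP] : forall x, exists n, E x -> [/\ 8 * n.+1%:R^-1 <= d,
    ball x (n.+1%:R^-1) `<=` W & t <= n.+1%:R ^+ 2 * fine (mu (ball x n.+1%:R^-1))].
  move=> x; have [Ex|] := pselect (E x); last by exists 0%N.
  have /nbhs_ballP[e0 /= e00 xeW] := open_nbhs_nbhs (conj oW (EW _ Ex)).
  have m0 : 0 < Num.min e0 (d / 8) by rewrite lt_min e00 divr_gt0.
  have [m _ mP] := near_infty_natSinv_lt (PosNum m0).
  have [n mn tn] := dE x Ex m; exists n => _.
  have := mP n mn; rewrite /= lt_min => /andP[ne nd]; split => //.
    by move: nd; move: (n.+1%:R^-1) => z; lra.
  by apply: subset_trans xeW; apply: le_ball; exact: ltW.
pose r x : R := (n x).+1%:R^-1.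
have r0 x : 0 < r x by rewrite invr_gt0.
pose B x : set V := ball x (r x).
have [D [DE tD cD]] := @vitali_levels _ _ B n E (fun x => ex_intro _ x (ballxx x (r0 x))).
(* Countability of [D]: disjoint balls contain distinct rational points, and [pickle] turns these
   into indices. Indices that are not attained give empty sets in [G] and [G']. *)
have /choice[v vP] : forall x, exists v : 'rV[rat]_3, B x (map_mx ratr v : V).
  by move=> x; exact: ex_rat_ball.
pose f x := pickle (v x).
have fI x y : D x -> D y -> f x = f y -> x = y.
  move=> Dx Dy /(pcan_inj pickleK) vxy; apply: tD => //.
  by exists (map_mx ratr (v x)); split; [exact: vP|rewrite vxy; exact: vP].
(* Only the points of [E] have to be covered, not the balls around them: if [B x] meets a [B y] of
   at least its radius, then [x] is within [2 r y] of [y]. Hence the factor 2. *)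
pose G k : set V := \bigcup_(x in [set x | D x /\ f x = k]) ball x (2 * r x).
pose G' k : set V := \bigcup_(x in [set x | D x /\ f x = k]) B x.
have Gcase k : (G k = set0 /\ G' k = set0) \/
    exists2 x, D x & (G k = ball x (2 * r x) /\ G' k = B x).
  have [[x [Dx fx]]|nx] := pselect (exists x, D x /\ f x = k); last first.
    by left; split; rewrite -subset0 => y [x [Dx fx] _]; case: nx; exists x.
  right; exists x => //.
  have S : [set x | D x /\ f x = k] = [set x].
    apply/seteqP; split => y /=; last by move=> ->.
    by move=> [Dy fy]; apply: fI => //; rewrite fx fy.
  by rewrite /G /G' S; split; rewrite bigcup_set1.
have EG : E `<=` \bigcup_k G k.
  move=> x Ex; have [y [Dy [z [xz yz]] yx]] := cD x Ex.
  exists (f y) => //; exists y => //.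
  have rxy : r x <= r y by rewrite lef_pV2 ?posrE// ler_nat.
  have -> : 2 * r y = r y + r y by ring.
  apply: ball_triangle yz _; apply: ball_sym; exact: le_ball rxy _ xz.
have mB x : measurable (B x) by exact: measurable_ball_rV.
have mG' k : measurable (G' k) by case: (Gcase k) => [[_ ->]//|[x _ [_ ->]]].
have diamG x : D x -> (ediam (ball x (2 * r x)) <= (8 * r x)%:E)%E.
  move=> Dx; have r2 : 0 < 2 * r x by rewrite mulr_gt0.
  by apply: le_trans (ediam_ball x r2) _; rewrite lee_fin mulrA -natrM.
apply: (@le_trans _ _ (\sum_(k <oo) (pi / 4)%:E * ediam (G k) ^+ 2)%E).
  apply: ereal_inf_lbound; exists G => //; split => // k.
  case: (Gcase k) => [[-> _]|[x Dx [-> _]]]; first by rewrite ediam0 lee_fin ltW.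
  by apply: le_trans (diamG x Dx) _; have [] := nP x (DE x Dx); rewrite lee_fin.
apply: (@le_trans _ _ (\sum_(k <oo) (64 / t)%:E * mu (G' k))%E).
  apply: lee_nneseries => [k _ _|k _]; first exact: hausdorff_term_ge0.
  case: (Gcase k) => [[-> ->]|[x Dx [-> ->]]]; first by rewrite hausdorff_term_set0 measure0 mule0.
  have [_ _ tx] := nP x (DE x Dx).
  have fB : mu (B x) \is a fin_num.
    rewrite ge0_fin_numE// (le_lt_trans _ mu_fin)//; apply: le_measure; rewrite ?inE//.
  apply: (@le_trans _ _ (1 * (8 * r x)%:E ^+ 2)%E).
    apply: lee_pmul => //.
    + by rewrite lee_fin divr_ge0 ?pi_ge0.
    + by rewrite expe_ge0// ediam_ge0.
    + by rewrite lee_fin ler_pdivrMr// mul1r; have := pihalf_lt2 R; lra.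
    + by rewrite !expe2 lee_pmul ?ediam_ge0 ?diamG.
  rewrite mul1e -(fineK fB) expe2 -!EFinM lee_fin.
  rewrite [leRHS]mulrAC ler_pdivlMr//.
  have -> : 8 * r x * (8 * r x) * t = 64 * (r x ^+ 2 * t) by ring.
  rewrite ler_pM2l// /r exprVn mulrC ler_pdivrMr ?exprn_gt0// mulrC.
  exact: tx.
rewrite nneseriesZl; last by move=> k _; exact: measure_ge0.
rewrite lee_pmul2l ?lte_fin ?divr_gt0//.
have mUG : measurable (\bigcup_k G' k) by exact: bigcupT_measurable.
rewrite -measure_semi_bigcup//.
  apply: le_measure; rewrite ?inE// => y [k _].
  case: (Gcase k) => [[_ ->]//|[x Dx [_ ->]]].
  by have [_ + _] := nP x (DE x Dx); apply.
move=> k l _ _ [y [[x1 [D1 <-] y1] [x2 [D2 <-] y2]]].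
by congr f; apply: tD => //; exists y.
Qed.
End density.

(** * Integrability from dyadic level sets *)

Section upper_bound.
Local Open Scope ereal_scope.
Import HBNNSimple.

(* No measurability is required because the integral is a supremum over simple
   functions; the jump set is not known to be measurable. *)
Lemma ge0_le_integral_setT d (T : measurableType d) (R : realType)
    (mu : {measure set T -> \bar R}) (D : set T) (f g : T -> \bar R) :
  (forall x, 0 <= f x) -> (forall x, 0 <= g x) -> (forall x, D x -> f x <= g x) ->
  \int[mu]_(x in D) f x <= \int[mu]_x g x.
Proof.
move=> f0 g0 fg; rewrite integral_mkcond.
have fD0 x : 0 <= (f \_ D) x by rewrite /patch; case: ifP.
rewrite !ge0_integralTE//.
apply: ereal_sup_le => _ [h hf <-]; exists h => // x.
apply: le_trans (hf x) _; rewrite /patch; case: ifPn => [/set_mem|_]; last exact: g0.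
exact: fg.
Qed.
End upper_bound.

Section level_sets.
Context {R : realType}.
Local Notation V := 'rV[R]_3.
Local Notation H2 := (@hausdorff2 R).
Variables (Omega : set V) (G : nat -> V -> R) (mu : {measure set V -> \bar R}).
Hypothesis mOmega : measurable Omega.
Hypothesis mG : forall n, measurable_fun setT (G n).
Hypothesis mu_fin : (mu setT < +oo)%E.
Hypothesis Gmu : forall x, Omega x -> \forall n \near \oo,
  `|G n x| <= n.+1%:R ^+ 2 * fine (mu (ball x n.+1%:R^-1)).

(** The points of [Omega] with [t < |G n x|] for infinitely many [n]. Unlike a level set of the
    limit, which exists only on the jump set, this set is Borel. *)
Definition level (t : R) : set V :=
  Omega `&` \bigcap_m \bigcup_(n in ~` `I_m) [set x | t < `|G n x|].

Lemma measurable_level t : measurable (level t).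
Proof.
apply: measurableI => //; apply: bigcapT_measurable => m.
apply: bigcup_measurable => n _.
rewrite (_ : [set x | _] = setT `&` (Num.norm \o G n) @^-1` `]t, +oo[%classic).
  by apply: measurableT_comp.
by apply/seteqP; split => x /=; rewrite in_itv/= andbT // => -[].
Qed.

Lemma level_antitone s t : s <= t -> level t `<=` level s.
Proof.
move=> st x [Ox h]; split => // m _; have [n nm tn] := h m I.
by exists n => //; exact: le_lt_trans st tn.
Qed.

(** The density bound involves the measure of an open neighbourhood; outer regularity shrinks it to
    [E], with the error [e / 64] compensating the constant. *)
Lemma hausdorff2_level t (E : set V) : 0 < t -> measurable E -> E `<=` level t ->
  (t%:E * H2 E <= 64%:E * mu E)%E.
Proof.
move=> t0 mE El; apply/lee_addgt0Pr => e e0.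
have e64 : 0 < e / 64 by rewrite divr_gt0.
have [W [oW EW mW]] := outer_regular mu_fin mE e64.
have : (H2 E <= (64 / t)%:E * mu W)%E.
  apply: hausdorff2_density => // x Ex m.
  have [Ox hx] := El x Ex; have [N _ hN] := Gmu Ox.
  have [n nm tn] := hx (maxn m N) I.
  have {}nm : (maxn m N <= n)%N by rewrite leqNgt; apply/negP.
  exists n; first exact: leq_trans (leq_maxl _ _) nm.
  by apply: le_trans (ltW tn) (hN n _); exact: leq_trans (leq_maxr _ _) nm.
move=> h; have pt : (0 <= t%:E)%E by rewrite lee_fin ltW.
have := lee_wpmul2l pt h.
move/le_trans; apply.
rewrite muleA -EFinM mulrCA divff ?mulr1 ?gt_eqF//.
have p64 : (0 <= 64%:E :> \bar R)%E by rewrite lee_fin.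
have := lee_wpmul2l p64 mW.
move/le_trans; apply.
rewrite ge0_muleDr ?lee_fin ?(ltW e64)// -EFinM.
by rewrite mulrC divfK.
Qed.

(* [pickle_inv] enumerates the integers [z], so that [dyadic] runs through the
   powers [2 ^ z]. *)
Definition dyadic (n : nat) : R := if @pickle_inv int n is Some z then 2 ^ z else 1.
Definition shell (n : nat) : set V :=
  if @pickle_inv int n is Some z then level (2 ^ z) `\` level (2 ^ (z + 1)) else set0.

Lemma dyadic_gt0 n : 0 < dyadic n.
Proof. by rewrite /dyadic; case: pickle_inv => // z; rewrite exprz_gt0. Qed.

Lemma measurable_shell n : measurable (shell n).
Proof.
by rewrite /shell; case: pickle_inv => // z; apply: measurableD; exact: measurable_level.
Qed.

Lemma shell_level n : shell n `<=` level (dyadic n).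
Proof. by rewrite /shell /dyadic; case: pickle_inv => // z x []. Qed.

Lemma trivIset_shell : trivIset setT shell.
Proof.
move=> n m _ _ [x []]; rewrite /shell.
have nE := @pickle_invK int n; have mE := @pickle_invK int m.
case: pickle_inv nE => // z nz; case: pickle_inv mE => // w mw [zx nzx] [wx nwx].
rewrite -[n]nz -[m]mw /=; congr pickle; apply/eqP; case: ltgtP => // zw.
  case: nzx; apply: level_antitone wx; rewrite ler_weXz2l ?ler1n//.
  by rewrite lezD1.
case: nwx; apply: level_antitone zx; rewrite ler_weXz2l ?ler1n//.
by rewrite lezD1.
Qed.

(** If [|G n x|] converges to [beta], then [x] lies in [level t] for all [t < beta] and for no
    [t > beta]; the boundary value [t = beta] is undecided. *)
Lemma shell_cover x (beta : R) : Omega x -> 0 < beta ->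
  `|G n x| @[n --> \oo] --> beta -> exists n, shell n x /\ beta <= 2 * dyadic n.
Proof.
move=> Ox b0 cG.
have lt_level t : t < beta -> level t x.
  move=> tb; split => // m _; have [N _ hN] := cvgr_gt _ cG _ tb.
  exists (maxn m N); last by apply: hN; exact: leq_maxr.
  by apply/negP; rewrite -leqNgt leq_maxl.
have level_le t : level t x -> t <= beta.
  move=> [_ h]; rewrite leNgt; apply/negP => bt.
  have [N _ hN] := cvgr_lt _ cG _ bt; have [n /negP nN tn] := h N I.
  rewrite -leqNgt in nN.
  by have := lt_trans tn (hN n nN); rewrite ltxx.
(* Shifting exponents by [N] turns the search for the least integer exponent into one over the
   naturals. *)
have [N Nb1 Nb2] : exists2 N : nat, beta <= 2 ^ N%:Z & 2 ^ (- N%:Z) < beta.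
  pose N := (Num.bound beta + Num.bound beta^-1)%N.
  have N2 : N%:R <= 2 ^+ N :> R by rewrite -natrX ler_nat ltnW// ltn_expl.
  exists N.
    apply: le_trans (ltW (archi_boundP (ltW b0))) _; apply: le_trans N2.
    by rewrite ler_nat leq_addr.
  rewrite -exprnN -[ltRHS]invrK ltf_pV2 ?posrE ?exprn_gt0 ?invr_gt0//.
  apply: lt_le_trans (archi_boundP _) _; first by rewrite invr_ge0 ltW.
  by apply: le_trans N2; rewrite ler_nat leq_addl.
have ex : exists k : nat, beta <= 2 ^ (k%:Z - N%:Z).
  by exists (N + N)%N; rewrite PoszD addrK.
case: (ex_minnP ex) => -[|k] bk kmin.
  by move: bk; rewrite sub0r leNgt Nb2.
have kb : 2 ^ (k%:Z - N%:Z) < beta.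
  by rewrite ltNge; apply/negP => /kmin; rewrite ltnn.
have two z : 2 ^ (z + 1) = 2 * 2 ^ z :> R by rewrite expfzDr// expr1z mulrC.
set z := (k%:Z - N%:Z) in kb *.
have zE : k.+1%:Z - N%:Z = z + 1 by rewrite /z -addn1 PoszD addrAC.
rewrite zE in bk.
(* Here [2 ^ z < beta <= 2 ^ (z + 1)]. Membership in the upper level forces [beta = 2 ^ (z + 1)],
   and [x] then belongs to the next shell; otherwise it belongs to shell [z]. *)
have [lz1|nlz1] := pselect (level (2 ^ (z + 1)) x).
  exists (pickle (z + 1)); rewrite /shell /dyadic pickleK_inv; split.
    split => // /level_le; rewrite two leNgt => /negP; apply.
    by apply: le_lt_trans bk _; rewrite ltr_pMl ?exprz_gt0// ltr1n.
  by apply: le_trans bk _; rewrite ler_pMl ?exprz_gt0// ler1n.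
exists (pickle z); rewrite /shell /dyadic pickleK_inv; split.
  by split => //; exact: lt_level.
by rewrite -two.
Qed.

(** On [J] the function [|f|] is at most twice the dyadic value of its shell. The shells are
    disjoint Borel sets, so this step function has integral at most [2 * 64] times the total mass of
    [mu]. *)
Lemma integral_level_bound (J : set (@hausdorff_type R)) (f : V -> R) :
  J `<=` Omega -> (forall x, J x -> G n x @[n --> \oo] --> f x) ->
  (\int[hausdorff2_measure]_(x in J) `|f x|%:E < +oo)%E.
Proof.
move=> JO cG.
have d0 n : 0 <= 2 * dyadic n by rewrite mulr_ge0// ltW// dyadic_gt0.
have mS n : measurable (shell n : set (@hausdorff_type R)).
  by apply: measurable_hausdorff; exact: measurable_shell.
pose T n (x : @hausdorff_type R) : \bar R := ((2 * dyadic n)%:E * (\1_(shell n) x)%:E)%E.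
have T0 n x : (0 <= T n x)%E by rewrite mule_ge0// lee_fin.
apply: (@le_lt_trans _ _ (\int[hausdorff2_measure]_x \sum_(n <oo) T n x)%E).
  apply: ge0_le_integral_setT => [x|x|x Jx].
  - by rewrite lee_fin.
  - by apply: nneseries_ge0 => n _ _.
  - have [->|fx] := eqVneq (f x) 0.
      by rewrite normr0; apply: nneseries_ge0 => n _ _.
    have fx0 : 0 < `|f x| by rewrite normr_gt0.
    have [n [sn fn]] := shell_cover (JO x Jx) fx0 (cvg_norm (cG x Jx)).
    apply: (@le_trans _ _ (T n x)).
      by rewrite /T indicE mem_set// mule1 lee_fin.
    apply: (@le_trans _ _ (\sum_(0 <= k < n.+1) T k x)%E).
      by rewrite big_nat_recr//= leeDr// sume_ge0.
    by apply: nneseries_lim_ge => k _ _.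
have mT n : measurable_fun setT (T n).
  apply: emeasurable_funM; first exact: measurable_cst.
  by apply/measurable_EFinP; exact: measurable_indic.
rewrite (@integral_nneseries _ _ _ hausdorff2_measure setT measurableT T mT (fun n x _ => T0 n x)).
apply: (@le_lt_trans _ _ (\sum_(n <oo) 128%:E * mu (shell n))%E).
  apply: lee_nneseries => [n _ _|n _]; first by apply: integral_ge0 => x _; exact: T0.
  have mI : measurable_fun setT (EFin \o (\1_(shell n) : @hausdorff_type R -> R)).
    by apply/measurable_EFinP; exact: measurable_indic.
  have I0 (x : @hausdorff_type R) : setT x -> (0 <= (\1_(shell n) x)%:E :> \bar R)%E.
    by move=> _; rewrite lee_fin.
  rewrite /T (@ge0_integralZl _ _ _ hausdorff2_measure setT measurableT _ mI _ I0); last by rewrite lee_fin.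
  rewrite (@integral_indic _ _ _ hausdorff2_measure setT measurableT _ (mS n)) setIT.
  have := hausdorff2_level (dyadic_gt0 n) (measurable_shell n) (@shell_level n).
  have p2 : (0 <= 2%:E :> \bar R)%E by rewrite lee_fin.
  move=> h; have := lee_wpmul2l p2 h.
  by rewrite !muleA -!EFinM -natrM.
rewrite nneseriesZl// -measure_semi_bigcup//.
- apply: lte_mul_pinfty => //.
  apply: le_lt_trans mu_fin; apply: le_measure; rewrite ?inE//.
  by apply: bigcupT_measurable => n; exact: measurable_shell.
- exact: measurable_shell.
- exact: trivIset_shell.
- by apply: bigcupT_measurable => n; exact: measurable_shell.
Qed.
End level_sets.

(** * Rank-one structure of the jump *)

Theorem lemma5p1 (R : realType) (Omega : set 'rV[R]_3)
    (Omega_open : open Omega) (Omega_bounded : bounded_set Omega)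
    (Omega_connected : connected Omega)
    (Omega_lipschitz : lipschitz_boundary Omega)
    (phi : 'rV[R]_3 -> 'rV[R]_3) (Dphi : 'rV[R]_3 -> 'M[R]_3)
    (phi_H1 : sobolev_H1 Omega phi) (Dphi_grad : weak_gradient Omega phi Dphi)
    (Dphi_BV : BV_mx Omega Dphi) :
  exists b : 'rV[R]_3 -> 'rV[R]_3,
    (forall i, hausdorff2_measure.-integrable (jump_set Omega Dphi)
                 (fun x => (b x 0 i)%:E)) /\
    {ae hausdorff2_measure, forall x, jump_set Omega Dphi x ->
       forall Up Um m, jump_triple Omega Dphi x Up Um m ->
         Up - Um = tensor (b x) m}.
Proof.
have iU i j : lebesgue3.-integrable Omega (EFin \o (fun y => Dphi y i j)).
  by have [] := Dphi_BV i j.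
pose G i n x := \sum_j blow Omega Dphi i j j n x.
(* [limn] takes an unspecified value where the sequence diverges; convergence is known at the jump
   points. *)
pose b x : 'rV[R]_3 := \row_i (kappa^-1 * limn (fun n => G i n x)).
have k0 : kappa != 0 :> R by rewrite lt_eqF// kappa_lt0.
have Gcvg x Up Um m i : jump_triple Omega Dphi x Up Um m ->
    G i n x @[n --> \oo] --> kappa * \sum_j (Up i j - Um i j) * m 0 j.
  move=> jt; rewrite mulr_sumr /G.
  under eq_fun do rewrite sum_ord3; rewrite sum_ord3.
  by apply: cvgD; [apply: cvgD|]; exact: blow_cvg.
have bE x Up Um m i : jump_triple Omega Dphi x Up Um m ->
    b x 0 i = \sum_j (Up i j - Um i j) * m 0 j.
  by move=> jt; rewrite mxE (cvg_lim _ (Gcvg _ _ _ _ i jt))// mulKf.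
have sym x Up Um m i j k : jump_triple Omega Dphi x Up Um m ->
    (Up i j - Um i j) * m 0 k = (Up i k - Um i k) * m 0 j.
  move=> jt; apply: (mulfI k0).
  have Ox : Omega x by case: jt.
  have c1 : blow Omega Dphi i j k n x @[n --> \oo] --> kappa * ((Up i j - Um i j) * m 0 k).
    exact: blow_cvg.
  have c2 : blow Omega Dphi i k j n x @[n --> \oo] --> kappa * ((Up i k - Um i k) * m 0 j).
    exact: blow_cvg.
  have c3 : blow Omega Dphi i j k n x @[n --> \oo] --> kappa * ((Up i k - Um i k) * m 0 j).
    apply: cvg_trans c2; apply: near_eq_cvg.
    exact: (blow_sym Omega_open iU i k j Dphi_grad Ox).
  exact: (cvg_unique (@Rhausdorff R) c1 c3).
have tensorE x Up Um m : jump_triple Omega Dphi x Up Um m -> Up - Um = tensor (b x) m.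
  move=> jt; apply/matrixP => i j; rewrite /tensor [RHS]mxE big_ord1 [in RHS]mxE (bE _ _ _ _ i jt).
  (* With [J = Up - Um], symmetry replaces [J_ik m_j m_k] by [J_ij m_k ^ 2], and the sum over [k] is
     [J_ij] because [m] is a unit vector. *)
  rewrite mulr_suml; under eq_bigr => k _ do rewrite mulrAC (sym x Up Um m i k j jt) -mulrA.
  have m1 : dotv m m = 1.
    by case: jt => _ + _ _ _; rewrite enorm_rV => h; rewrite -(sqr_sqrtr (dotv_ge0 m)) h expr1n.
  by rewrite -mulr_sumr -/(dotv m m) m1 mulr1 !mxE.
exists b; split; last first.
  by apply: aeW => x _ Up Um m; exact: tensorE.
move=> i; have [mu mu_fin Gmu] := blow_bound Omega_open iU Dphi_BV i.
have JO : jump_set Omega Dphi `<=` Omega by move=> x [Up [Um [m []]]].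
have mG n : measurable_fun setT (G i n).
  by apply: measurable_sum => j; exact: measurable_blow.
have cG x : jump_set Omega Dphi x -> G i n x @[n --> \oo] --> kappa * b x 0 i.
  by move=> [Up [Um [m jt]]]; rewrite (bE x Up Um m i jt); exact: Gcvg.
have cb x : jump_set Omega Dphi x -> kappa^-1 * G i n x @[n --> \oo] --> b x 0 i.
  move=> Jx; rewrite -[X in _ --> X](mulKf k0).
  by apply: cvgMr; exact: cG.
have mGb n : measurable_fun setT (fun x => kappa^-1 * G i n x) by exact: measurable_funM.
apply/integrableP; split.
  apply/measurable_EFinP.
  (* [measurable_fun] on a domain takes the measurability of that domain as its premise [mJ]; the
     preimages are Borel, hence measurable for [H^2]. *)
  have mGJ n : measurable_fun (jump_set Omega Dphi : set (@hausdorff_type R))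
      (fun x => kappa^-1 * G i n x).
    move=> mJ B mB; apply: measurableI; first exact: mJ.
    by apply: measurable_hausdorff; rewrite -[X in measurable X]setTI; exact: mGb.
  exact: (@measurable_fun_cvg _ (@hausdorff_type R) R _ _ (fun x => b x 0 i) mGJ cb).
have kn0 : 0 <= `|kappa|^-1 :> R by rewrite invr_ge0.
(* The functions converging to [b] carry the factor [kappa^-1], which is absorbed into the
   measure. *)
pose mu' : {measure set 'rV[R]_3 -> \bar R} := mscale (NngNum kn0) mu.
have mu'E B : mu' B = (`|kappa|^-1%:E * mu B)%E by [].
have mu'_fin : (mu' setT < +oo)%E by rewrite mu'E lte_mul_pinfty.
have Gmu' x : Omega x -> \forall n \near \oo, `|kappa^-1 * G i n x| <=
    n.+1%:R ^+ 2 * fine (mu' (ball x n.+1%:R^-1)).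
  move=> Ox; apply: filterS (Gmu x Ox) => n h.
  have mB := measurable_ball_rV x n.+1%:R^-1.
  have fB : mu (ball x n.+1%:R^-1) \is a fin_num.
    by rewrite ge0_fin_numE// (le_lt_trans _ mu_fin)//; apply: le_measure; rewrite ?inE.
  by rewrite mu'E fineM//= mulrCA normrM normfV ler_wpM2l.
exact: (integral_level_bound (open_measurable_rV Omega_open) mGb mu'_fin Gmu' JO cb).
Qed.
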